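(* There is an algorithm that, given a $P_8$-free chordal graph $G$ with $n$ vertices and $m$ edges, enumerates the family $\mathcal{D}_{RN}(G)$ (each member exactly once) with $O(n^2\cdot m)$ delay, using $O(n^2)$ space.
   Context: All graphs are finite, simple and undirected. $N[x]$ is the closed neighbourhood of $x$ and $N[X]=\bigcup_{x\in X}N[x]$. A minimal dominating set of $G$ is an inclusion-minimal set $D$ with $N[D]=V(G)$. A vertex $x$ is irredundant if $N[x]$ is inclusion-minimal in $\{N[y]:y\in V(G)\}$, with the convention that among several vertices having the same inclusion-minimal closed neighbourhood exactly one (fixed) is declared irredundant; all other vertices are redundant; $RN(G)$ is the set of redundant vertices. $\mathcal{D}_{RN}(G)=\{D\cap RN(G): D\text{ a minimal dominating set of }G\}$. $P_k$-free means no induced path on $k$ vertices; chordal means no induced cycle of length at least four. The delay is the maximum time before the first output, between consecutive outputs, and after the last output. *)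

(* Defs.v *)
From mathcomp Require Import all_boot.

Set Implicit Arguments.
Unset Strict Implicit.
Unset Printing Implicit Defensive.

(** * Graphs

    A finite simple graph on the vertex set 'I_n is a symmetric irreflexive
    [e : rel 'I_n]. *)

Section Graphs.
Variables (n : nat) (e : rel 'I_n).

Definition num_edges : nat :=
  #|[set p : 'I_n * 'I_n | (p.1 < p.2) && e p.1 p.2]|.

Definition clnbh (x : 'I_n) : {set 'I_n} := [set y | (y == x) || e x y].

Definition clnbhs (X : {set 'I_n}) : {set 'I_n} := \bigcup_(x in X) clnbh x.

Definition dominating (D : {set 'I_n}) : bool := clnbhs D == [set: 'I_n].

Definition min_dominating (D : {set 'I_n}) : bool := minset dominating D.

(* Among the vertices sharing a given inclusion-minimal closed neighbourhood,
   the one declared irredundant is that of least index.  As graphs are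
   arbitrarily labelled, every other choice of representatives is obtained from
   this one by relabelling. *)
Definition irredundant (x : 'I_n) : bool :=
  minset (mem [set clnbh y | y : 'I_n]) (clnbh x) &&
  [forall y : 'I_n, (clnbh y == clnbh x) ==> (x <= y)].

Definition RN : {set 'I_n} := [set x | ~~ irredundant x].

Definition D_RN : {set {set 'I_n}} :=
  [set D :&: RN | D : {set 'I_n} & min_dominating D].

Definition has_induced (k : nat) (h : rel 'I_k) : Prop :=
  exists f : 'I_k -> 'I_n, injective f /\ forall i j, e (f i) (f j) = h i j.

Definition path_graph (k : nat) : rel 'I_k :=
  fun i j => (j == i.+1 :> nat) || (i == j.+1 :> nat).

Definition cycle_graph (k : nat) : rel 'I_k :=
  fun i j => (j == i.+1 %% k :> nat) || (i == j.+1 %% k :> nat).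

Definition path_free (k : nat) : Prop := ~ has_induced (@path_graph k).

Definition chordal : Prop :=
  forall k, 4 <= k -> ~ has_induced (@cycle_graph k).

(* Every edge is listed exactly once, in one of its two orientations; nothing
   is assumed on the order of the list. *)
Definition edge_list (es : seq ('I_n * 'I_n)) : Prop :=
  forall x y, count_mem (x, y) es + count_mem (y, x) es = e x y.

End Graphs.

(** * Model of computation

    Structured programs for a unit-cost word RAM: a program has finitely many
    registers (named by natural numbers), a random-access memory of words, and
    a write-only output.  A run is described by the sequence of the elementary
    operations that it performs, each of which takes one unit of time.  Words
    are a priori unbounded; [max_word] measures the largest one in a run, so
    that "O(log n)-bit words" can be imposed on it. *)

Inductive binop := Add | Sub | Mul | Div | Mod | Eqb | Ltb.

Inductive expr :=
  | Const of nat
  | Reg of nat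
  | Read of expr
  | Bin of binop & expr & expr.

Inductive com :=
  | Skip
  | Assign of nat & expr
  | Write of expr & expr        (* address, value *)
  | Seq of com & com
  | If of expr & com & com
  | While of expr & com
  | Print of expr               (* append a word to the current solution *)
  | EndSol.                     (* the current solution is complete *)

Record state := State { regs : nat -> nat; memory : nat -> nat }.

Inductive event :=
  | EvOp of nat                 (* computed word *)
  | EvRead of nat & nat         (* address, word *)
  | EvWrite of nat & nat        (* address, word *)
  | EvPrint of nat
  | EvEnd.

Definition upd (f : nat -> nat) (a v : nat) : nat -> nat :=
  fun b => if b == a then v else f b.

Definition set_reg (s : state) (x v : nat) : state :=
  State (upd (regs s) x v) (memory s).

Definition set_mem (s : state) (a v : nat) : state :=
  State (regs s) (upd (memory s) a v).

(* Subtraction is truncated; division by 0 yields 0, and i mod 0 = i. *)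
Definition eval_binop (o : binop) (i j : nat) : nat :=
  match o with
  | Add => i + j
  | Sub => i - j
  | Mul => i * j
  | Div => i %/ j
  | Mod => i %% j
  | Eqb => i == j
  | Ltb => i < j
  end.

Fixpoint eval (s : state) (a : expr) : nat :=
  match a with
  | Const k => k
  | Reg x => regs s x
  | Read a1 => memory s (eval s a1)
  | Bin o a1 a2 => eval_binop o (eval s a1) (eval s a2)
  end.

Fixpoint eval_trace (s : state) (a : expr) : seq event :=
  match a with
  | Const _ | Reg _ => [:: EvOp (eval s a)]
  | Read a1 => rcons (eval_trace s a1) (EvRead (eval s a1) (eval s a))
  | Bin _ a1 a2 =>
      rcons (eval_trace s a1 ++ eval_trace s a2) (EvOp (eval s a))
  end.

(* [exec c s tr s']: from state [s], [c] terminates in state [s'] after having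
   performed exactly the operations [tr]. *)
Inductive exec : com -> state -> seq event -> state -> Prop :=
  | ExecSkip s : exec Skip s [::] s
  | ExecAssign s x a :
      exec (Assign x a) s (eval_trace s a) (set_reg s x (eval s a))
  | ExecWrite s a b :
      exec (Write a b) s
        (rcons (eval_trace s a ++ eval_trace s b)
               (EvWrite (eval s a) (eval s b)))
        (set_mem s (eval s a) (eval s b))
  | ExecSeq c1 c2 s1 tr1 s2 tr2 s3 :
      exec c1 s1 tr1 s2 -> exec c2 s2 tr2 s3 ->
      exec (Seq c1 c2) s1 (tr1 ++ tr2) s3
  | ExecIfTrue a c1 c2 s tr s' :
      eval s a != 0 -> exec c1 s tr s' ->
      exec (If a c1 c2) s (eval_trace s a ++ tr) s'
  | ExecIfFalse a c1 c2 s tr s' :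
      eval s a = 0 -> exec c2 s tr s' ->
      exec (If a c1 c2) s (eval_trace s a ++ tr) s'
  | ExecWhileTrue a c s1 tr1 s2 tr2 s3 :
      eval s1 a != 0 -> exec c s1 tr1 s2 -> exec (While a c) s2 tr2 s3 ->
      exec (While a c) s1 (eval_trace s1 a ++ tr1 ++ tr2) s3
  | ExecWhileFalse a c s :
      eval s a = 0 -> exec (While a c) s (eval_trace s a) s
  | ExecPrint a s :
      exec (Print a) s (rcons (eval_trace s a) (EvPrint (eval s a))) s
  | ExecEndSol s : exec EndSol s [:: EvEnd] s.

(* The memory initially contains n, m and the m edges; all other cells, and all
   registers, contain 0. *)
Definition encode (n : nat) (es : seq ('I_n * 'I_n)) : seq nat :=
  [:: n, size es & flatten [seq [:: val p.1; val p.2] | p <- es]].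

Definition init (input : seq nat) : state :=
  State (fun=> 0) (fun a => nth 0 input a).

(** * Delay, space and output of a run *)

(* Cuts a trace after each [EvEnd]: a trace with k solutions gives k + 1
   segments, the last one being what happens after the last solution. *)
Fixpoint segments (tr : seq event) : seq (seq event) :=
  match tr with
  | [::] => [:: [::]]
  | EvEnd :: tr' => [:: EvEnd] :: segments tr'
  | ev :: tr' => (ev :: head [::] (segments tr')) :: behead (segments tr')
  end.

Definition delay (tr : seq event) : nat :=
  \max_(sg <- segments tr) size sg.

Definition cell_bound (ev : event) : nat :=
  match ev with EvRead a _ | EvWrite a _ => a.+1 | _ => 0 end.

(* The length of the shortest initial part of the memory, input included,
   outside of which no cell is accessed.  The registers are not counted: their
   number depends on the program only. *)
Definition space (tr : seq event) : nat := \max_(ev <- tr) cell_bound ev.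

Definition event_word (ev : event) : nat :=
  match ev with
  | EvOp v | EvPrint v => v
  | EvRead a v | EvWrite a v => maxn a v
  | EvEnd => 0
  end.

Definition max_word (tr : seq event) : nat := \max_(ev <- tr) event_word ev.

Definition printed (ev : event) : option nat :=
  if ev is EvPrint v then Some v else None.

Definition output (tr : seq event) : seq (seq nat) :=
  [seq pmap printed sg | sg <- segments tr].

(* The solutions written are duplicate-free lists of the members of the members
   of [F], each member of [F] being written exactly once, and nothing is
   written after the last solution. *)
Definition enumerates (n : nat) (tr : seq event) (F : {set {set 'I_n}}) : Prop :=
  exists sols : seq (seq 'I_n),
    [/\ output tr = rcons [seq [seq val x | x <- sol] | sol <- sols] [::],
        all uniq sols
      & perm_eq [seq [set:: sol] | sol <- sols] (enum F)].

(* Main.v *)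
(** A set [A] of redundant vertices belongs to [D_RN] as soon as every vertex of
    [A] has an irredundant private neighbour [p] that blocks no undominated
    irredundant vertex, that is, such that no undominated irredundant vertex has
    all its irredundant neighbours in [N[p]].  These privates can be chosen one
    vertex at a time: the vertices [a] of [A] owning no inclusion-minimal closed
    neighbourhood start an induced path [p - a - b - t], with [b] in [A] and [t]
    private to [b], so that two of them with conflicting privates yield an
    induced path on 8 vertices.  By the same argument the removal of such an [a]
    leaves [A] in [D_RN]; when there is none, any vertex can be removed.  This
    makes [D_RN] a tree rooted at the empty set, although it is not closed under
    subsets.  The tree is traversed depth-first without a stack, the parent being
    recomputed.  One membership test takes O(n^2) and a node has at most
    |RN| <= 2m candidate children, hence O(n^2 m) per node; printing the nodes
    of even depth on entry and those of odd depth on exit, at most two moves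
    separate two solutions. *)
Require Import Defs.
From mathcomp Require Import all_boot zify.

Set Implicit Arguments.
Unset Strict Implicit.
Unset Printing Implicit Defensive.

(** * Redundant traces of minimal dominating sets *)

(** Induced paths are never checked pair by pair. In a chordal graph a walk whose vertices two steps
    apart are distinct and non-adjacent is induced, so a forbidden path on 8 vertices amounts to
    seven edges and six non-adjacencies.

    Privates that are harmless one by one might still jointly cover all irredundant neighbours of an
    undominated [u]. A private [p] of [a] with [N p] inside [N a] takes no part in this, since [a]
    dominates all of [N p]. Hence a private adjacent to [u] belongs to a vertex of [Lset], which
    supplies half of the forbidden path; the other half comes from a second private. The removal
    rule has the same origin: a removal can only spoil the private of a member of [Lset], and the
    path argument needs the removed vertex to be in [Lset] too.

    The delay must be proportional to [m] even if [m < n]. Neighbourhood inclusions are therefore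
    tabulated once, by scanning edges, membership tests only look them up, and graphs without edges
    are answered before any table is filled. *)

Section Graph.
Variables (n : nat) (e : rel 'I_n).
Hypotheses (e_sym : symmetric e) (e_irr : irreflexive e).

Local Notation N := (clnbh e).
Local Notation RN := (RN e).

Lemma mem_clnbh x y : (y \in N x) = (y == x) || e x y.
Proof. by rewrite inE. Qed.

Lemma clnbh_sym x y : (y \in N x) = (x \in N y).
Proof. by rewrite !mem_clnbh eq_sym e_sym. Qed.

Lemma clnbh_refl x : x \in N x.
Proof. by rewrite mem_clnbh eqxx. Qed.

Lemma clnbh_edge x y : x != y -> y \in N x -> e x y.
Proof. by rewrite mem_clnbh eq_sym => /negPf->. Qed.

(** * Induced paths from locally induced walks in chordal graphs *)

Section LocallyInducedWalk.
Hypothesis chor : chordal e.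
Variables (f : nat -> 'I_n) (k : nat).
Hypothesis f_step : forall i, i.+1 < k -> e (f i) (f i.+1).
Hypothesis f_skip : forall i, i.+2 < k -> f i.+2 \notin N (f i).

(* A shortest chord of the walk would close an induced cycle. *)
Lemma locally_induced_walk d i :
  0 < d -> i + d < k -> f i != f (i + d) /\ e (f i) (f (i + d)) = (d == 1).
Proof.
elim/ltn_ind: d i => -[//|[|[|d]]] IH i _ lt_k.
- rewrite addn1 in lt_k *; rewrite (f_step lt_k); split=> //.
  by apply: contraTneq (f_step lt_k) => <-; rewrite e_irr.
- have := @f_skip i; rewrite addn2 in lt_k *; move=> /(_ lt_k).
  by rewrite mem_clnbh negb_or eq_sym => /andP[-> /negPf->].
have far s t : s < t -> t < s + d.+3 -> i + t < k ->
    f (i + s) != f (i + t) /\ e (f (i + s)) (f (i + t)) = (t == s.+1).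
  move=> lt_st lt_ts lt_tk.
  have E : i + t = i + s + (t - s) by rewrite -addnA subnKC // ltnW.
  have lt_d : t - s < d.+3 by rewrite ltn_subLR // ltnW.
  have := IH (t - s) lt_d (i + s); rewrite -E subn_gt0 => /(_ lt_st lt_tk)[-> ->].
  split=> //.
  by rewrite -(eqn_add2r s) subnK ?add1n // ltnW.
have eF : e (f i) (f (i + d.+3)) = false.
  apply/negP => e_ij; apply: (chor (k := d.+4)) => //.
  have cyc (s t : 'I_d.+4) : s < t ->
      f (i + s) != f (i + t) /\ e (f (i + s)) (f (i + t)) = cycle_graph s t.
    move=> lt_st; rewrite /cycle_graph.
    have lt_s : s.+1 < d.+4 by apply: leq_ltn_trans lt_st (ltn_ord t).
    rewrite (modn_small lt_s).
    have [tE|t_neq] := eqVneq (t : nat) d.+3.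
      rewrite tE modnn; have [->|s0] := posnP s.
        rewrite addn0 e_ij; split; last by rewrite ?eqxx orbT.
        by apply: contraTneq e_ij => <-; rewrite e_irr.
      have := far s t lt_st; rewrite tE -[X in X < _]add0n ltn_add2r.
      move=> /(_ s0 lt_k)[-> ->].
      by split=> //; case: (val s) s0 => // ?; rewrite orbF.
    have lt_t : t < d.+3 by rewrite ltn_neqAle t_neq -ltnS ltn_ord.
    have [] := far s t lt_st.
    - by rewrite (leq_trans lt_t) // leq_addl.
    - by rewrite (leq_trans _ lt_k) // ltnS leq_add2l ltnW.
    move=> -> ->.
    split=> //; rewrite modn_small // [(s : nat) == _]ltn_eqF ?orbF //.
    exact: leqW.
  exists (fun s : 'I_d.+4 => f (i + s)); split.
    move=> s t; case: (ltngtP s t) => [lt|lt|/val_inj//] E.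
      by have [/eqP] := cyc _ _ lt.
    by have [] := cyc _ _ lt; rewrite E eqxx.
  move=> s t; case: (ltngtP s t) => [lt|lt|/val_inj<-].
  - by have [] := cyc _ _ lt.
  - by have [_] := cyc _ _ lt; rewrite e_sym /cycle_graph orbC.
  rewrite e_irr /cycle_graph orbb; apply/esym/negP => /eqP.
  have [sE|s_neq] := eqVneq (s : nat) d.+3; first by rewrite sE modnn.
  rewrite modn_small; last by rewrite ltnS ltn_neqAle s_neq -ltnS ltn_ord.
  by move/n_Sn.
(* If the ends coincided, the last step of the walk would join [f (i + d.+2)] to [f i], against
   [far]. *)
split=> //; apply/eqP => fE.
have lt_k' : i + d.+2 < k by rewrite ltnW // -addnS.
have [] := far 0 d.+2 isT (ltnSn _) lt_k'; rewrite addn0 => _.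
by rewrite fE e_sym (addnS i d.+2) f_step // -addnS.
Qed.

End LocallyInducedWalk.

(** Only consecutive pairs and pairs two steps apart are examined; chordality settles the others.
    All contradictions with [path_free] are reached in this form. *)
Lemma no_induced_path8 : path_free e 8 -> chordal e ->
  forall x0 x1 x2 x3 x4 x5 x6 x7,
  [/\ e x0 x1, e x1 x2, e x2 x3 & e x3 x4] ->
  [/\ e x4 x5, e x5 x6 & e x6 x7] ->
  [/\ x2 \notin N x0, x3 \notin N x1 & x4 \notin N x2] ->
  [/\ x5 \notin N x3, x6 \notin N x4 & x7 \notin N x5] -> False.
Proof.
move=> pf ch x0 x1 x2 x3 x4 x5 x6 x7 [e01 e12 e23 e34] [e45 e56 e67].
move=> [n02 n13 n24] [n35 n46 n57].
pose f i := nth x0 [:: x0; x1; x2; x3; x4; x5; x6; x7] i.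
have W := @locally_induced_walk ch f 8.
have lW (i j : 'I_8) : i < j -> f i != f j /\ e (f i) (f j) = path_graph i j.
  move=> lt_ij; have [] := W _ _ (j - i) i.
  - by do 7! [case=> //].
  - by do 7! [case=> //].
  - by rewrite subn_gt0.
  - by rewrite subnKC ?ltn_ord // ltnW.
  rewrite subnKC ?(ltnW lt_ij) // => -> ->; split=> //.
  rewrite /path_graph [(i : nat) == _]ltn_eqF ?orbF; last exact: leqW.
  by rewrite -(eqn_add2r i) subnK ?add1n // ltnW.
apply: pf; exists (fun i : 'I_8 => f i); split=> [i j|i j].
  case: (ltngtP i j) => [lt|lt|/val_inj//] E.
    by have [/eqP] := lW _ _ lt.
  by have [] := lW _ _ lt; rewrite E eqxx.
case: (ltngtP i j) => [lt|lt|/val_inj<-].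
- by have [] := lW _ _ lt.
- by have [_] := lW _ _ lt; rewrite e_sym /path_graph orbC.
by rewrite e_irr /path_graph orbb; apply/esym/negP => /eqP/n_Sn.
Qed.

(** Take a minimal closed neighbourhood inside [N y] and its owner of least index. Domination thus
    needs testing on irredundant vertices only. *)
Lemma irr_below y : exists2 p, p \notin RN & N p \subset N y.
Proof.
pose F : {set {set 'I_n}} := [set N z | z : 'I_n].
have [|B /minsetP[/imsetP[z _ ->] min_z] sBy] := @minset_exists _ (mem F) (N y).
  by apply: imset_f.
case: (arg_minnP (P := fun p => N p == N z) (i0 := z) val (eqxx _)) => p /eqP pz min_p.
exists p; last by rewrite pz.
rewrite inE negbK /irredundant pz; apply/andP; split.
  by apply/minsetP; split=> //; apply/imsetP; exists z.
by apply/forallP => q; apply/implyP => qz; apply: min_p.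
Qed.

Lemma irr_incomp p q : p \notin RN -> q \notin RN -> N p \subset N q -> p = q.
Proof.
rewrite !inE !negbK => /andP[_ /forallP mp] /andP[/minsetP[_ minq] /forallP mq] spq.
have E : N p = N q by apply: minq => //; apply: imset_f.
apply/val_inj/anti_leq; rewrite (implyP (mp q)) ?E //.
by rewrite (implyP (mq p)) ?E.
Qed.

(** Redundancy as a test on pairs, ready for tabulation: [y] rules out [x] if its closed
    neighbourhood is strictly smaller, or equal with [y] of smaller index. *)
Lemma mem_RN x : (x \in RN) =
  [exists y, (N y \subset N x) && ~~ ((N x \subset N y) && (x <= y))].
Proof.
apply/idP/idP => [|/existsP[y /andP[syx nxy]]].
  move=> xR; have [p pI spx] := irr_below x; apply/existsP; exists p.
  rewrite spx /=; apply: contra pI => /andP[sxp le_xp].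
  have E : N p = N x by apply/eqP; rewrite eqEsubset spx.
  move: xR; rewrite !inE /irredundant E; apply: contra => /andP[-> /forallP mp] /=.
  apply/forallP => z; apply/implyP => zx; apply: leq_trans le_xp _.
  by rewrite (implyP (mp z)).
rewrite inE; apply/negP => /andP[/minsetP[_ minx] /forallP mx].
have E : N y = N x by apply: minx => //; apply: imset_f.
by move: nxy; rewrite E subxx (implyP (mx y)) ?E.
Qed.

(** * A local criterion for sets of redundant vertices *)

Definition ndom (A : {set 'I_n}) u := #|N u :&: A|.

(** Keeping [p] private bars the irredundant part of the dominating set from [N p]; if this swallows
    all irredundant neighbours of an undominated [u], nothing is left to dominate [u]. *)
Definition bad A p := [exists u,
  [&& u \notin RN, ndom A u == 0 & N u :\: RN \subset N p]].

Definition okp A a := [exists p,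
  [&& p \notin RN, ndom A p == 1, p \in N a & ~~ bad A p]].

(** For [a] in [A], such a private has no undominated vertex in its closed neighbourhood. *)
Definition okw A a := [exists p,
  [&& p \notin RN, ndom A p == 1 & N p \subset N a]].

Definition good (A : {set 'I_n}) := (A \subset RN) && [forall a in A, okp A a].

Definition Lset (A : {set 'I_n}) := [set a in A | ~~ okw A a].

Definition private A a p := [/\ p \notin RN, p \in N a & N p :&: A = [set a]].

Lemma ndom0P A u a : ndom A u == 0 -> a \in A -> a \notin N u.
Proof.
rewrite cards_eq0 => /eqP N0 aA; apply/negP => aN.
by have := in_set0 a; rewrite -N0 inE aN aA.
Qed.

Lemma ndom1P A a p : p \notin RN -> ndom A p == 1 -> p \in N a -> a \in A ->
  private A a p.
Proof.
move=> pI /cards1P[b E] paN aA; split=> //.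
suff -> : a = b by [].
by apply/set1P; rewrite -E inE aA clnbh_sym paN.
Qed.

Lemma private_ndom A a p : private A a p -> ndom A p == 1.
Proof. by case=> _ _ E; rewrite /ndom E cards1. Qed.

Lemma private_other A a b p : private A a p -> b \in A -> b != a -> b \notin N p.
Proof.
case=> _ _ E bA; apply: contra => bN.
by rewrite -in_set1 -E inE bN.
Qed.

Lemma good_RN A a : good A -> a \in A -> a \in RN.
Proof. by case/andP=> /subsetP sA _; apply: sA. Qed.

Lemma goodP A a : good A -> a \in A -> exists2 p, private A a p & ~~ bad A p.
Proof.
case/andP=> _ /forallP/(_ a)/implyP ok aA.
have /existsP[p /and4P[pI p1 pa pb]] := ok aA.
by exists p => //; apply: ndom1P.
Qed.

Lemma priv_edge A a p : good A -> a \in A -> private A a p -> e a p.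
Proof.
move=> gA aA [pI pa _]; apply: clnbh_edge pa.
by apply: contraNneq pI => <-; apply: good_RN gA aA.
Qed.

Lemma L_sub A a : a \in Lset A -> a \in A.
Proof. by rewrite inE => /andP[]. Qed.

(** An irredundant [s] with [N s] inside [N a] is not private to [a], so a second vertex [b] of [A]
    lies in [N s], hence in [N a]; [t] is a private of [b]. Any private [p] of [a] completes the
    half path [t], [b], [a], [p]. *)
Lemma L_tail A a : good A -> a \in Lset A -> exists b t,
  [/\ e t b, e b a, a \notin N t
    & forall p, private A a p -> p \notin N b /\ b \notin N p].
Proof.
move=> gA aL; have aA := L_sub aL; have aR := good_RN gA aA.
have [s sI ssa] := irr_below a.
have s_a : s \in N a by apply: (subsetP ssa); rewrite clnbh_refl.
have [b /setIP[bs bA] ba] : exists2 b, b \in N s :&: A & b != a.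
  apply/exists_inP; apply: contraTT aL; rewrite negb_exists_in => /forallP all_a.
  rewrite inE aA /= negbK; apply/existsP; exists s; rewrite sI ssa andbT /=.
  apply/cards1P; exists a; apply/setP => b; rewrite !inE -[(b == s) || _]mem_clnbh.
  apply/idP/eqP => [bN|->]; last by rewrite aA clnbh_sym s_a.
  by apply/eqP; have := implyP (all_a b); rewrite inE negbK; apply.
have [t [tI tb tA] _] := goodP gA bA.
exists b, t; split.
- rewrite e_sym; apply: clnbh_edge tb.
  by apply: contraNneq tI => <-; apply: good_RN gA bA.
- by rewrite e_sym clnbh_edge 1?eq_sym // (subsetP ssa).
- by apply: (@private_other A b) => //; rewrite eq_sym.
move=> p pp; have := private_other pp bA ba; split=> //.
by rewrite clnbh_sym.
Qed.

(** Outside [Lset] the private is chosen with its neighbourhood inside [N a]: it sees no undominated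
    vertex, so it cannot be bad. *)
Lemma exists_private (A : {set 'I_n}) : good A -> exists P : 'I_n -> 'I_n,
  forall a, a \in A ->
    [/\ private A a (P a), ~~ bad A (P a) & a \in Lset A \/ N (P a) \subset N a].
Proof.
move=> gA.
have H (a : 'I_n) : exists p : 'I_n, (a \in A) ==>
    [&& p \notin RN, p \in N a, ndom A p == 1, ~~ bad A p &
        (a \in Lset A) || (N p \subset N a)].
  have [aA|] := boolP (a \in A); last by exists a.
  have [aL|] := boolP (a \in Lset A).
    have [p pp pb] := goodP gA aA; exists p.
    by rewrite (private_ndom pp) pb; case: pp => -> ->.
  rewrite inE aA /= negbK => /existsP[p /and3P[pI p1 spa]]; exists p.
  rewrite pI p1 spa (subsetP spa) ?clnbh_refl //= andbT.
  apply/negP => /existsP[u /and3P[uI u0 sup]].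
  have := ndom0P u0 aA; rewrite clnbh_sym (subsetP spa) //.
  by rewrite (subsetP sup) // inE uI clnbh_refl.
have [P HP] := fin_all_exists H; exists P => a aA.
have /and5P[pI pa p1 pb /orP pL] := implyP (HP a) aA.
by split=> //; apply: ndom1P.
Qed.

(** * Conflicting privates yield an induced path on 8 vertices *)

Section P8.
Hypotheses (pf : path_free e 8) (ch : chordal e).
Let no8 := no_induced_path8 pf ch.

(** Two half paths from [L_tail] are glued along an edge [p q]: [t], [a'], [a], [p], [q], [b], [b'],
    [t']. *)
Lemma L_privates_far A a b p q : good A -> a \in Lset A -> b \in Lset A ->
  a != b -> private A a p -> private A b q -> ~~ e p q.
Proof.
move=> gA aL bL nab pa qb; apply/negP => epq.
have [aA bA] := (L_sub aL, L_sub bL).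
have [a' [t [e1 e2 n1 /(_ _ pa)[n2 n2']]]] := L_tail gA aL.
have [b' [t' [e3 e4 n3 /(_ _ qb)[n4 n4']]]] := L_tail gA bL.
have e5 := priv_edge gA aA pa; have e6 := priv_edge gA bA qb.
apply: (no8 (x0 := t) (x1 := a') (x2 := a) (x3 := p) (x4 := q) (x5 := b)
  (x6 := b') (x7 := t')); split=> //; try by rewrite e_sym.
- by rewrite clnbh_sym (private_other qb).
- by rewrite (private_other pa) // eq_sym.
by rewrite clnbh_sym.
Qed.

(** The other privates stay private. Such a [P a] can turn bad only through a vertex [u] of
    [N (P a)] that [r] alone dominated. This forces [a], hence [r], into [Lset], where adjacent
    privates are excluded. *)
Lemma good_remove A r : good A -> r \in A -> r \in Lset A \/ Lset A = set0 ->
  good (A :\ r).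
Proof.
move=> gA rA rL; have /andP[sAR _] := gA.
apply/andP; split; first exact: subset_trans (subsetDl _ _) sAR.
have [P HP] := exists_private gA.
apply/forallP => a; apply/implyP => /setD1P[nar aA].
have [pp pb pL] := HP a aA; have [pI pa pA] := pp.
apply/existsP; exists (P a); rewrite pI pa /=.
have -> /= : ndom (A :\ r) (P a) == 1.
  apply/cards1P; exists a; rewrite setIDA pA; apply/setP => b; rewrite !inE.
  by have [->|] := eqVneq b a; rewrite ?nar // andbF.
apply/negP => /existsP[u /and3P[uI u0 sup]].
have u_p : u \in N (P a) by apply: (subsetP sup); rewrite inE uI clnbh_refl.
have u_a : a \notin N u by apply: ndom0P u0 _; rewrite !inE nar.
have aL : a \in Lset A.
  by case: pL => // /subsetP sp; case/negP: u_a; rewrite clnbh_sym sp.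
have {}rL : r \in Lset A by case: rL => // L0; rewrite L0 inE in aL.
(* Otherwise [u] was undominated already, and [P a] was bad before the removal. *)
have ur : private A r u.
  have ru : r \in N u.
    apply: contraNT pb => ru; apply/existsP; exists u; rewrite uI sup andbT /=.
    rewrite -(eqP u0); apply/eqP; apply: eq_card => b; rewrite !inE.
    by have [->|//] := eqVneq b r; move: ru; rewrite mem_clnbh => /negPf->; rewrite ?andbF.
  split; rewrite 1?clnbh_sym //; apply/setP => b; rewrite in_set1 in_setI.
  have [->|nbr] := eqVneq b r; first by rewrite ru rA.
  apply/negP => /andP[bu bA]; have bA' : b \in A :\ r by rewrite !inE nbr.
  by have := ndom0P u0 bA'; rewrite bu.
have /negP[] := L_privates_far gA aL rL nar pp ur.
apply: clnbh_edge u_p; apply: contraNneq u_a => <-.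
by rewrite clnbh_sym.
Qed.

(* Each [P a] is good on its own; the point is that they do not conflict. *)
Lemma good_joint A P : good A ->
  (forall a, a \in A -> [/\ private A a (P a), ~~ bad A (P a)
      & a \in Lset A \/ N (P a) \subset N a]) ->
  forall u, u \notin RN -> ndom A u == 0 ->
  exists y, [/\ y \in N u, y \notin RN & forall a, a \in A -> y \notin N (P a)].
Proof.
move=> gA HP u uI u0.
have [/existsP[y /and3P[yu yI /forall_inP yP]]|no_y] := boolP [exists y,
    [&& y \in N u, y \notin RN & [forall a in A, y \notin N (P a)]]].
  by exists y.
have cover y : y \in N u -> y \notin RN -> exists2 a, a \in A & y \in N (P a).
  move=> yu yI; move: no_y; rewrite negb_exists => /forallP/(_ y).
  rewrite yu yI /= => /forall_inPn[a aA]; rewrite negbK => yP.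
  by exists a.
have inL a : a \in A -> u \in N (P a) -> a \in Lset A.
  move=> aA uP; have [_ _ []// /subsetP sP] := HP a aA.
  by have := ndom0P u0 aA; rewrite clnbh_sym sP.
have uP a : a \in A -> u \in N (P a) -> e (P a) u.
  move=> aA; apply: clnbh_edge; have [[_ Pa _] _ _] := HP a aA.
  by have := ndom0P u0 aA; rewrite clnbh_sym; apply: contraNneq => <-.
(* [u] is irredundant, so it must itself be covered. *)
have [a aA ua] := cover u (clnbh_refl u) uI.
have aL := inL _ aA ua; have [pa nba _] := HP a aA.
have e_pu := uP _ aA ua.
(* [P a] is not bad, so some irredundant [y] of [N u] escapes it and is covered by another private
   [P b]. *)
have [y [yu yI yp]] : exists y, [/\ y \in N u, y \notin RN & y \notin N (P a)].
  move: nba; rewrite negb_exists => /forallP/(_ u); rewrite uI u0 /=.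
  by case/subsetPn => y /setDP[yu yI] yp; exists y.
have [b bA yb] := cover y yu yI.
have [pb _ _] := HP b bA.
have nab : a != b by apply: contraNneq yp => ->.
have [a' [t [e1 e2 n1 /(_ _ pa)[n2 n2']]]] := L_tail gA aL.
have e3 := priv_edge gA aA pa.
have n3 : u \notin N a by rewrite clnbh_sym; apply: ndom0P u0 aA.
(* If [u] is in [N (P b)] as well, the path passes through both privates: [t], [a'], [a], [P a],
   [u], [P b], [b], [b']. *)
have [uPb|uPb] := boolP (u \in N (P b)).
  have bL := inL _ bA uPb.
  have [b' [t' [e4 e5 n4 /(_ _ pb)[n5 n5']]]] := L_tail gA bL.
  have := L_privates_far gA aL bL nab pa pb => nPP.
  apply: False_ind; apply: (no8 (x0 := t) (x1 := a') (x2 := a) (x3 := P a) (x4 := u)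
    (x5 := P b) (x6 := b) (x7 := b')); split=> //.
  - by rewrite e_sym uP.
  - by rewrite e_sym (priv_edge gA bA pb).
  - by rewrite e_sym.
  - rewrite mem_clnbh (negPf nPP) orbF; apply: contraNneq (private_other pa bA _).
      by move<-; rewrite clnbh_sym; case: pb.
    by rewrite eq_sym.
  - exact: ndom0P u0 bA.
apply: False_ind.
have nyP : y != P b by apply: contraNneq uPb => <-; rewrite clnbh_sym.
(* Distinct irredundant vertices have incomparable neighbourhoods, so [z] prolongs the path beyond
   [P b]: [t], [a'], [a], [P a], [u], [y], [P b], [z]. *)
have [z zP zy] : exists2 z, z \in N (P b) & z \notin N y.
  apply/subsetPn; apply/negP => /irr_incomp H; case/eqP: nyP.
  by apply/esym/H => //; case: pb.
have nuy : u != y by apply: contraNneq yp => <-.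
apply: (no8 (x0 := t) (x1 := a') (x2 := a) (x3 := P a) (x4 := u)
    (x5 := y) (x6 := P b) (x7 := z)); split=> //.
- exact: clnbh_edge yu.
- by rewrite e_sym clnbh_edge // eq_sym.
- apply: clnbh_edge zP; apply: contraNneq zy => <-.
  by rewrite clnbh_sym.
by rewrite clnbh_sym.
Qed.

Lemma dominatingP (D : {set 'I_n}) :
  reflect (forall u, u \notin RN -> exists2 d, d \in D & d \in N u) (dominating e D).
Proof.
apply: (iffP eqP) => [E u _|H].
  have : u \in clnbhs e D by rewrite E inE.
  by case/bigcupP=> d dD ud; exists d; rewrite // clnbh_sym.
apply/eqP; rewrite eqEsubset subsetT; apply/subsetP => y _.
have [p pI spy] := irr_below y; have [d dD dp] := H p pI.
by apply/bigcupP; exists d => //; rewrite clnbh_sym (subsetP spy).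
Qed.

(** Necessity: if deleting [a] from [D] leaves [y] undominated, an irredundant [p] below [y] is
    private to [a]. It is not bad, because an irredundant dominator of [u] in [D] would lie in [N p]
    and so be [a], which is redundant. Sufficiency: [A] is completed by all irredundant vertices
    outside every [N (P a)], then thinned to a minimal dominating set; no [a] gets lost, as it alone
    dominates [P a]. *)
Lemma D_RN_good A : (A \in D_RN e) = good A.
Proof.
apply/imsetP/idP => [[D DM ->]|gA].
  have /minsetP[domD minD] : minset (dominating e) D by rewrite inE in DM.
  apply/andP; split; first exact: subsetIr.
  apply/forall_inP => a /setIP[aD aR].
  have [p pI pD] : exists2 p, p \notin RN & N p :&: D = [set a].
    have : ~~ dominating e (D :\ a).
      apply: contraL aD => domDa.
      by rewrite -(minD _ domDa (subsetDl _ _)) !inE eqxx.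
    rewrite /dominating eqEsubset subsetT => /subsetPn[y _ yD].
    have [p pI spy] := irr_below y; exists p => //.
    have [d dD dp] := dominatingP _ domD p pI.
    have only b : b \in D -> b \in N p -> b = a.
      move=> bD bp; apply: contraNeq yD => nba; apply/bigcupP; exists b.
        by rewrite !inE nba.
      by rewrite clnbh_sym (subsetP spy).
    apply/setP => b; rewrite in_setI in_set1; apply/andP/eqP => [[bp bD]|->].
      exact: only.
    by rewrite -(only d).
  have pA : N p :&: (D :&: RN) = [set a].
    by rewrite setIA pD; apply/setIidPl; rewrite sub1set.
  have ap : a \in N p by have := set11 a; rewrite -pD => /setIP[].
  apply/existsP; exists p; rewrite pI /ndom pA cards1 eqxx clnbh_sym ap /=.
  apply/negP => /existsP[u /and3P[uI u0 /subsetP sup]].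
  have [d dD du] := dominatingP _ domD u uI.
  have dI : d \notin RN.
    by apply: contraL du => dR; apply: ndom0P u0 _; rewrite inE dD.
  have : d \in [set a] by rewrite -pD inE dD sup // inE dI.
  by move/set1P => dE; rewrite dE aR in dI.
have [P HP] := exists_private gA; have /andP[sAR _] := gA.
pose I := [set v | (v \notin RN) && [forall a in A, v \notin N (P a)]].
have domAI : dominating e (A :|: I).
  apply/dominatingP => u uI; have [u0|] := boolP (ndom A u == 0).
    have [y [yu yI yP]] := good_joint gA HP uI u0.
    by exists y; rewrite // in_setU in_set yI orbC; apply/orP; left; apply/forall_inP.
  by rewrite cards_eq0 => /set0Pn[d /setIP[du dA]]; exists d; rewrite // in_setU dA.
have [D minD sD] := minset_exists domAI; exists D; first by rewrite inE.
have /minsetP[domD _] := minD.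
apply/setP => a; rewrite in_setI; apply/idP/andP => [aA|[aD aR]]; last first.
  by have /setUP[//|] := subsetP sD a aD; rewrite in_set aR.
split; last exact: (subsetP sAR).
have [[pI _ pA] _ _] := HP a aA.
have [d dD dp] := dominatingP _ domD _ pI.
suff <- : d = a by [].
have /setUP[dA|] := subsetP sD d dD; first by apply/set1P; rewrite -pA inE dp.
by rewrite inE => /andP[_ /forall_inP/(_ a aA)]; rewrite dp.
Qed.

End P8.
End Graph.

(** * Reverse search *)

Section ReverseSearch.
Variables (n : nat) (good : pred {set 'I_n}) (r : {set 'I_n} -> nat).
Hypothesis r_good : forall A, good A -> A != set0 ->
  exists2 a : 'I_n, a \in A /\ r A = a & good (A :\ a).

(** Comparing values lets [r] return a number that names no vertex, as happens on the empty set. *)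
Definition parent (A : {set 'I_n}) := [set a in A | val a != r A].

Definition child (A : {set 'I_n}) (y : 'I_n) :=
  [&& y \notin A, good (y |: A) & r (y |: A) == y].

(* Sets of even size are listed before their descendants, the other ones after
   them. *)
Definition branch (f : {set 'I_n} -> seq {set 'I_n}) A y :=
  if child A y then
    if odd #|A| then y |: A :: f (y |: A) else rcons (f (y |: A)) (y |: A)
  else [::].

Fixpoint below d A :=
  if d is d'.+1 then flatten [seq branch (below d') A y | y <- enum 'I_n]
  else [::].

Lemma mem_branch f A y B :
  (B \in branch f A y) = child A y && ((B == y |: A) || (B \in f (y |: A))).
Proof.
rewrite /branch; case: (child A y) => //=.
by case: odd; rewrite ?mem_rcons inE.
Qed.

Lemma parent_child A y : child A y -> parent (y |: A) = A.
Proof.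
case/and3P=> yA _ /eqP E; apply/setP => a; rewrite in_set E in_setU1.
have [->|nay] := eqVneq a y; first by rewrite eqxx (negPf yA).
by rewrite (inj_eq val_inj) nay andbT.
Qed.

Lemma parentE A : good A -> A != set0 -> exists2 a,
  parent A = A :\ a & [/\ a \in A, r A = a & good (A :\ a)].
Proof.
move=> gA /(r_good gA)[a [aA rE] ga]; exists a => //.
by apply/setP => b; rewrite !inE rE (inj_eq val_inj) andbC.
Qed.

Lemma good_iter_parent B i : good B -> i <= #|B| ->
  good (iter i parent B) /\ #|iter i parent B| = #|B| - i.
Proof.
move=> gB; elim: i => [|i IH] lt_i; first by rewrite subn0.
have [gi ci] := IH (ltnW lt_i); rewrite iterS.
have [|a -> [aA _ ga]] := parentE gi; first by rewrite -card_gt0 ci subn_gt0.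
by split=> //; rewrite subnS -ci (cardsD1 a (iter i _ _)) aA.
Qed.

(** Membership is read off the chain of ancestors of [B]. Completeness and the absence of
    repetitions both follow from this form. *)
Lemma mem_below d A B : (B \in below d A) =
  [&& good B, #|A| < #|B|, #|B| <= #|A| + d & iter (#|B| - #|A|) parent B == A].
Proof.
elim: d A B => [|d IH] A B.
  by rewrite addn0 ltnNge; case: (_ <= _); rewrite ?andbF.
apply/flatten_mapP/idP => [[y _]|].
  rewrite mem_branch IH => /andP[chA].
  have [yA gA' _] := and3P chA.
  rewrite cardsU1 yA add1n => /orP[/eqP->|/and4P[-> lt_A le_B /eqP E]].
    rewrite gA' cardsU1 yA add1n ltnSn addnS ltnS leq_addr subSnn /=.
    by rewrite parent_child.
  rewrite (ltnW lt_A) addnS -addSn le_B /=.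
  have -> : #|B| - #|A| = (#|B| - #|A|.+1).+1 by rewrite subnSK // ltnW.
  by rewrite iterS E parent_child.
case/and4P=> gB lt_A le_B /eqP E.
pose k := #|B| - #|A|.+1.
have kE : #|B| - #|A| = k.+1 by rewrite subnSK.
have [gA' cA'] := good_iter_parent gB (leq_subr _ _ : k <= #|B|).
rewrite subKn // in cA'; rewrite kE iterS in E.
have [|y pE [yA' rA' _]] := parentE gA'; first by rewrite -card_gt0 cA'.
have A'E : iter k parent B = y |: A by rewrite -E pE setD1K.
have yA : y \notin A by rewrite -E pE !inE eqxx.
exists y; first by rewrite mem_enum.
rewrite mem_branch /child yA -A'E gA' rA' eqxx IH /= gB cA' A'E addSnnS le_B -/k eqxx.
have [_|le_B'] := ltnP; first by rewrite orbT.
by rewrite -A'E /k (eqP le_B') eqxx.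
Qed.

Lemma uniq_below d A : uniq (below d A).
Proof.
elim: d A => [//|d IH] A /=.
(* [B] determines its branch: its ancestor with one vertex more than [A] is [y |: A]. Distinct
   branches are therefore disjoint. *)
have branch_inv y B : B \in branch (below d) A y ->
    y \notin A /\ y |: A = iter (#|B| - #|A|.+1) parent B.
  rewrite mem_branch mem_below => /andP[/and3P[yA _ _]].
  rewrite cardsU1 yA => /orP[/eqP->|/and4P[_ _ _ /eqP<- //]].
  by rewrite cardsU1 yA subnn.
elim: (enum 'I_n) (enum_uniq 'I_n) => //= y ys IHys /andP[yys uys].
rewrite cat_uniq IHys // andbT; apply/andP; split.
  rewrite /branch; case: ifP => // /and3P[yA _ _].
  by case: odd; rewrite ?rcons_uniq /= IH mem_below ltnn andbF.
apply/hasPn => B /flatten_mapP[z zys /branch_inv[zA Ez]].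
apply/negP => /branch_inv[yA Ey].
have : y \in z |: A by rewrite Ez -Ey setU11.
by rewrite in_setU1 (negPf yA) orbF => /eqP yz; rewrite yz zys in yys.
Qed.

(** Each passage to the parent loses one vertex, so [#|B|] of them lead a good [B] to the empty
    set. *)
Lemma perm_below d (F : {set {set 'I_n}}) : good set0 -> n <= d ->
  (forall A, (A \in F) = good A) -> perm_eq (set0 :: below d set0) (enum F).
Proof.
move=> g0 le_nd FE; apply: uniq_perm.
- by rewrite /= uniq_below mem_below ltnn andbF.
- exact: enum_uniq.
move=> B; rewrite inE mem_enum FE mem_below cards0 subn0 add0n card_gt0.
have [->|nB0] := eqVneq B set0; first by rewrite g0.
have -> : #|B| <= d by rewrite (leq_trans _ le_nd) // -[n in _ <= n]card_ord max_card.
case: (boolP (good B)) => //= gB.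
have [_] := good_iter_parent gB (leqnn _); rewrite subnn => /eqP.
by rewrite cards_eq0.
Qed.

End ReverseSearch.

(** * The vertex whose removal gives the parent *)

Section Removed.
Variables (n : nat) (e : rel 'I_n).

(** The vertices to which [good_remove] applies. *)
Definition cand (A : {set 'I_n}) := [set a in A | (Lset e A == set0) || (a \in Lset e A)].

(** The least candidate as an index; the value is [n] on the empty set. *)
Definition removed (A : {set 'I_n}) := find (mem (cand A)) (enum 'I_n).

Lemma removed_spec A : A != set0 -> exists a : 'I_n,
  [/\ a \in A, removed A = a & a \in Lset e A \/ Lset e A = set0].
Proof.
move=> A0; have hasA : has (mem (cand A)) (enum 'I_n).
  have [L0|/set0Pn[a aL]] := eqVneq (Lset e A) set0.
    have [a aA] := set0Pn _ A0; apply/hasP; exists a; first by rewrite mem_enum.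
    by rewrite inE in_set L0 eqxx aA.
  apply/hasP; exists a; first by rewrite mem_enum.
  by rewrite inE in_set aL orbT (L_sub aL).
have lt_n : removed A < n by rewrite -[n in _ < n]size_enum_ord -has_find.
exists (Ordinal lt_n); have a0 : 'I_n by exists (removed A).
have := nth_find a0 hasA; rewrite -/(removed A).
rewrite (_ : nth _ _ _ = Ordinal lt_n) => [|]; last first.
  by apply: val_inj; rewrite /= nth_enum_ord.
rewrite inE in_set => /andP[aA aL]; split=> //.
by case/orP: aL => [/eqP|]; [right|left].
Qed.

End Removed.

(** * Program logic *)

(** Both the time of an evaluation and the exponent in the word bound. *)
Fixpoint esize (a : expr) : nat :=
  match a with
  | Const _ | Reg _ => 1
  | Read a1 => (esize a1).+1
  | Bin _ a1 a2 => (esize a1 + esize a2).+1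
  end.

(** Constants up to 2 never exceed the base [V + 2] of the word bound. *)
Fixpoint small_consts (a : expr) : bool :=
  match a with
  | Const k => k <= 2
  | Reg _ => true
  | Read a1 => small_consts a1
  | Bin _ a1 a2 => small_consts a1 && small_consts a2
  end.

Lemma size_eval_trace s a : size (eval_trace s a) = esize a.
Proof.
elim: a => //= [a1 <-|o a1 <- a2 <-]; first by rewrite size_rcons.
by rewrite size_rcons size_cat.
Qed.

Section ProgramLogic.
Variables (V S K : nat).

(* When registers and cells hold words at most [V], an expression of size [K]
   only computes words at most [(V + 2) ^ K]: no finer word bound is tracked. *)
Definition bounded s := (forall x, regs s x <= V) /\ (forall a, memory s a <= V).

Definition word_bound := (V + 2) ^ K.

Definition ev_ok ev :=
  (cell_bound ev <= S) && (event_word ev <= word_bound).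

(** Events that do not complete a solution, so that a trace of them stays within one segment. *)
Definition silent_free ev := if ev is EvEnd then false else ev_ok ev.

Fixpoint reads_below s a : Prop :=
  match a with
  | Const _ | Reg _ => True
  | Read a1 => reads_below s a1 /\ eval s a1 < S
  | Bin _ a1 a2 => reads_below s a1 /\ reads_below s a2
  end.

Definition admissible a := small_consts a && (esize a <= K).

(** Sums as well as products are at most the product of the two powers; for sums this needs both
    powers to be at least 2, whence the base [V + 2]. *)
Lemma eval_bound s a : bounded s -> small_consts a ->
  eval s a <= (V + 2) ^ esize a.
Proof.
move=> [br bm]; have V0 : 0 < V + 2 by rewrite addn2.
have Vle x i : x <= V + 2 -> x <= (V + 2) ^ i.+1.
  by move=> h; rewrite expnS (leq_trans h) // leq_pmulr // expn_gt0 V0.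
have VV x : x <= V -> x <= V + 2 by move=> h; rewrite (leq_trans h) // leq_addr.
have V2 i : 0 < i -> 1 < (V + 2) ^ i.
  by case: i => // i _; apply: Vle; rewrite addn2.
elim: a => [k|x|a1 IH|o a1 IH1 a2 IH2] //=.
- by move=> h; apply: Vle; rewrite (leq_trans h) // addn2.
- by move=> _; apply/Vle/VV/br.
- by move=> _; apply/Vle/VV/bm.
case/andP=> /IH1{}IH1 /IH2{}IH2.
set x := eval s a1 in IH1 *; set y := eval s a2 in IH2 *.
have lift z : z <= (V + 2) ^ (esize a1 + esize a2) ->
    z <= (V + 2) ^ (esize a1 + esize a2).+1.
  by move=> h; rewrite (leq_trans h) // leq_exp2l ?addn2.
have es0 a : 0 < esize a by case: a.
have lx : x <= (V + 2) ^ (esize a1 + esize a2).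
  by rewrite (leq_trans IH1) // leq_exp2l ?addn2 // leq_addr.
case: o => /=.
- apply: lift; rewrite (leq_trans (leq_add IH1 IH2)) // expnD.
  have := V2 _ (es0 a1); have := V2 _ (es0 a2).
  by move: (_ ^ _) (_ ^ _) => p q; nia.
- exact/lift/(leq_trans (leq_subr _ _)).
- by apply: lift; rewrite expnD leq_mul.
- exact/lift/(leq_trans (leq_div _ _)).
- exact/lift/(leq_trans (leq_mod _ _)).
- by apply: Vle; case: eqP; rewrite addn2.
- by apply: Vle; case: ltnP; rewrite addn2.
Qed.

Lemma eval_trace_ok s a : bounded s -> admissible a -> reads_below s a ->
  all silent_free (eval_trace s a) /\ pmap printed (eval_trace s a) = [::].
Proof.
move=> bs /andP[]; have V0 : 0 < V + 2 by rewrite addn2.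
have bE b : small_consts b -> esize b <= K -> eval s b <= word_bound.
  move=> sb eb; rewrite (leq_trans (eval_bound bs sb)) // /word_bound leq_exp2l //.
  by rewrite addn2.
elim: a => [k|x|a1 IH|o a1 IH1 a2 IH2].
- by move=> sb eb _ /=; rewrite andbT /ev_ok /= (bE (Const k)).
- by move=> sb eb _ /=; rewrite andbT /ev_ok /= (bE (Reg x)).
- move=> sb eb /= [r1 r2]; have [|ok1 p1] := IH sb _ r1.
    by apply: leq_trans eb => /=.
  rewrite all_rcons ok1 /= /ev_ok /= r2 geq_max (bE a1) ?(bE (Read a1)) //.
    by split=> //; rewrite -cats1 pmap_cat p1.
  by apply: leq_trans eb.
move=> sb eb /= [r1 r2]; have /andP[sb1 sb2] := sb.
have [|ok1 p1] := IH1 sb1 _ r1.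
  by apply: leq_trans eb => /=; rewrite leqW // leq_addr.
have [|ok2 p2] := IH2 sb2 _ r2.
  by apply: leq_trans eb => /=; rewrite leqW // leq_addl.
rewrite all_rcons all_cat ok1 ok2 /= andbT /ev_ok /= (bE (Bin o a1 a2)) //.
by rewrite -cats1 !pmap_cat p1 p2.
Qed.

(** A total-correctness triple with a time budget. Boundedness is both assumed and restored, so
    sequencing passes it on silently. *)
Definition wp c s t (out : seq nat) (Q : state -> Prop) :=
  bounded s -> exists tr s', [/\ exec c s tr s', all silent_free tr,
    pmap printed tr = out /\ size tr <= t, bounded s' & Q s'].

Lemma wp_weaken c s t t' o (Q Q' : state -> Prop) :
  wp c s t o Q -> t <= t' -> (forall s', Q s' -> Q' s') -> wp c s t' o Q'.
Proof.
move=> H le_t QQ bs; have [tr [s' [ex ok [po st] bs' q]]] := H bs.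
by exists tr, s'; split=> //; [split=> //; apply: leq_trans le_t | apply: QQ].
Qed.

Lemma wp_skip s (Q : state -> Prop) : Q s -> wp Skip s 0 [::] Q.
Proof. by move=> q bs; exists [::], s; split=> //; constructor. Qed.

Lemma wp_assign s x a (Q : state -> Prop) :
  admissible a -> reads_below s a -> eval s a <= V ->
  Q (set_reg s x (eval s a)) -> wp (Assign x a) s (esize a) [::] Q.
Proof.
move=> ad ra le_V q bs; have [ok po] := eval_trace_ok bs ad ra.
exists (eval_trace s a), (set_reg s x (eval s a)); split=> //.
- by constructor.
- by rewrite size_eval_trace.
case: bs => br bm; split=> //= y; rewrite /upd.
by case: eqP.
Qed.

Lemma wp_write s a b (Q : state -> Prop) :
  admissible a -> admissible b -> reads_below s a -> reads_below s b ->
  eval s a < S -> eval s b <= V ->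
  Q (set_mem s (eval s a) (eval s b)) ->
  wp (Write a b) s (esize a + esize b).+1 [::] Q.
Proof.
move=> ada adb ra rb lt_S le_V q bs.
have [oka poa] := eval_trace_ok bs ada ra.
have [okb pob] := eval_trace_ok bs adb rb.
eexists _, _; split; first by constructor.
- rewrite all_rcons all_cat oka okb /= andbT /ev_ok /= lt_S geq_max.
  have V2 : 1 < V + 2 by rewrite addn2.
  have bE c : admissible c -> eval s c <= word_bound.
    case/andP=> sc ec; rewrite (leq_trans (eval_bound bs sc)) // /word_bound.
    by rewrite leq_exp2l.
  by rewrite !bE.
- by rewrite -cats1 !pmap_cat poa pob size_cat size_cat addn1 !size_eval_trace.
- case: bs => br bm; split=> //= y; rewrite /upd.
  by case: eqP.
by [].
Qed.

Lemma wp_seq c1 c2 s t1 t2 o1 o2 (Q : state -> Prop) :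
  wp c1 s t1 o1 (fun s1 => wp c2 s1 t2 o2 Q) ->
  wp (Seq c1 c2) s (t1 + t2) (o1 ++ o2) Q.
Proof.
move=> H bs; have [tr1 [s1 [ex1 ok1 [po1 st1] bs1 H1]]] := H bs.
have [tr2 [s2 [ex2 ok2 [po2 st2] bs2 q]]] := H1 bs1.
exists (tr1 ++ tr2), s2; split=> //; first exact: ExecSeq ex1 ex2.
  by rewrite all_cat ok1.
by rewrite pmap_cat po1 po2 size_cat leq_add.
Qed.

Lemma wp_if a c1 c2 s t o (Q : state -> Prop) :
  admissible a -> reads_below s a ->
  wp (if eval s a != 0 then c1 else c2) s t o Q ->
  wp (If a c1 c2) s (esize a + t) o Q.
Proof.
move=> ad ra H bs; have [tr [s' [ex ok [po st] bs' q]]] := H bs.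
have [oka poa] := eval_trace_ok bs ad ra.
exists (eval_trace s a ++ tr), s'; split=> //.
- by move: ex; case: ifPn => [a0|/negPn/eqP a0]; [apply: ExecIfTrue|apply: ExecIfFalse].
- by rewrite all_cat oka.
by rewrite pmap_cat poa size_cat size_eval_trace leq_add2l.
Qed.

Lemma wp_print s a : admissible a -> reads_below s a ->
  wp (Print a) s (esize a).+1 [:: eval s a] (eq s).
Proof.
move=> ad ra bs; have [oka poa] := eval_trace_ok bs ad ra.
have /andP[sa ea] := ad.
eexists _, _; split; [by constructor | | | by [] | by []].
  rewrite all_rcons oka /= andbT /ev_ok /= (leq_trans (eval_bound bs sa)) //.
  by rewrite /word_bound leq_exp2l // addn2.
by rewrite -cats1 pmap_cat poa size_cat size_eval_trace addn1.
Qed.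

Definition incr x := Assign x (Bin Add (Reg x) (Const 1)).

Definition for_loop i l body :=
  While (Bin Ltb (Reg i) (Reg l)) (Seq body (incr i)).

(** A round pays 3 for the guard and 3 for the increment; the last 3 are the failing guard. The
    invariant at [j.+1] refers to the state after the increment. *)
Lemma wp_for i l body (Inv : nat -> state -> Prop) (o : nat -> seq nat) len t :
  2 < K -> len <= V ->
  (forall j s, Inv j s -> regs s i = j /\ regs s l = len) ->
  (forall j s, j < len -> Inv j s ->
     wp body s t (o j)
       (fun s' => regs s' i = j /\ Inv j.+1 (set_reg s' i j.+1))) ->
  forall s, Inv 0 s ->
  wp (for_loop i l body) s (len * (t + 6) + 3)
    (flatten [seq o j | j <- iota 0 len]) (Inv len).
Proof.
move=> K2 le_V Hreg Hbody.
suff H d j s : j + d = len -> Inv j s ->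
    wp (for_loop i l body) s (d * (t + 6) + 3)
      (flatten [seq o j | j <- iota j d]) (Inv len).
  by move=> s; apply: H.
elim: d j s => [|d IH] j s.
  rewrite addn0 => E I bs; rewrite E in I; have [ri rl] := Hreg _ _ I.
  have [|//|ok po] := @eval_trace_ok s (Bin Ltb (Reg i) (Reg l)) bs.
    by rewrite /admissible.
  exists (eval_trace s (Bin Ltb (Reg i) (Reg l))), s; split=> //.
  by apply: ExecWhileFalse; rewrite /= ri rl ltnn.
move=> jd I bs; have [ri rl] := Hreg _ _ I.
have lt_j : j < len by rewrite -jd -[X in X < _]addn0 ltn_add2l.
have [tr1 [s1 [ex1 ok1 [po1 st1] bs1 [ri1 I1]]]] := Hbody j s lt_j I bs.
have [||||tr2 [s2 [ex2 ok2 [po2 st2] bs2 e2]]] :=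
  @wp_assign s1 i (Bin Add (Reg i) (Const 1)) (eq (set_reg s1 i j.+1)) _ _ _ _ bs1.
- by rewrite /admissible.
- by [].
- by rewrite /= ri1 addn1 (leq_trans lt_j).
- by rewrite /= ri1 addn1.
have [||tr3 [s3 [ex3 ok3 [po3 st3] bs3 I3]]] := IH j.+1 s2 _ _ bs2.
- by rewrite addSnnS.
- by rewrite -e2.
have [|//|ok po] := @eval_trace_ok s (Bin Ltb (Reg i) (Reg l)) bs.
  by rewrite /admissible.
exists (eval_trace s (Bin Ltb (Reg i) (Reg l)) ++ (tr1 ++ tr2) ++ tr3), s3; split=> //.
- apply: ExecWhileTrue ex3; first by rewrite /= ri rl lt_j.
  exact: ExecSeq ex1 ex2.
- by rewrite all_cat ok !all_cat ok1 ok2.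
rewrite !pmap_cat po po1 po2 po3 cats0; split=> //.
rewrite !size_cat size_eval_trace /=; move: st1 st2 st3 => /=; lia.
Qed.

End ProgramLogic.

Lemma wp_seq0 V S K c1 c2 s t1 t2 o (Q : state -> Prop) :
  wp V S K c1 s t1 [::] (fun s1 => wp V S K c2 s1 t2 o Q) ->
  wp V S K (Seq c1 c2) s (t1 + t2) o Q.
Proof. exact: wp_seq. Qed.

Lemma wp_Skip V S K s t (Q : state -> Prop) : Q s -> wp V S K Skip s t [::] Q.
Proof. by move=> q; apply: (@wp_weaken _ _ _ _ _ 0 _ _ Q) => //; apply: wp_skip. Qed.

Lemma updE f a v b : upd f a v b = if b == a then v else f b.
Proof. by []. Qed.

Definition tab k a := Read (Bin Add (Reg (10 + k)) a).

(** * Filling tables *)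

(* Registers 0 to 3 hold n, m, n ^ 2 and 1, and register 10 + k the address of
   the k-th table, of n ^ 2 cells.  A stage fills table [k] up to the value of
   register [len]; cell number reg 4 = n * reg 7 + reg 8 gets the value of
   register 6 after the iteration of [e] for reg 5 ranging below [cnt]. *)
Definition stage k len cnt e0 e :=
  Seq (Assign 4 (Const 0)) (for_loop 4 len
    (Seq (Assign 7 (Bin Div (Reg 4) (Reg 0)))
    (Seq (Assign 8 (Bin Mod (Reg 4) (Reg 0)))
    (Seq (Assign 6 e0)
    (Seq (Assign 5 (Const 0))
    (Seq (for_loop 5 cnt (Assign 6 e))
         (Write (Bin Add (Reg (10 + k)) (Reg 4)) (Reg 6)))))))).

Definition scratch x := 4 <= x < 9.

Section Layout.
Variables (n m : nat) (inp : nat -> nat).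

(** The input takes [2 + 2m] cells; the twelve tables follow it. *)
Definition table_base k := 2 + m.*2 + k * (n * n).
(** A common bound for addresses, input words, counters and tabulated values. *)
Definition word_limit := table_base 12 + n + 2.
Definition space_limit := table_base 12.
(** A generous bound on the size of the expressions of the program; it becomes a factor of the
    exponent [w]. *)
Definition expr_limit := 120.

Notation WP := (wp word_limit space_limit expr_limit).
Notation reads_ok := (reads_below space_limit).
Notation adm := (admissible expr_limit).

Record env (s : state) : Prop := Env {
  env_n : regs s 0 = n;
  env_m : regs s 1 = m;
  env_nn : regs s 2 = n * n;
  env_one : regs s 3 = 1;
  env_base : forall k, k < 12 -> regs s (10 + k) = table_base k;
  env_inp : forall a, a < table_base 0 -> memory s a = inp a }.

(** What a stage may change: scratch registers and table [k]. Index 12 lies past the last table, so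
    [frame 12] preserves all tables. *)
Definition frame k s s' :=
  (forall x, ~~ scratch x -> regs s' x = regs s x) /\
  (forall a, ~~ (table_base k <= a < table_base k.+1) -> memory s' a = memory s a).

Lemma frame_trans k s1 s2 s3 : frame k s1 s2 -> frame k s2 s3 -> frame k s1 s3.
Proof.
by move=> [r1 m1] [r2 m2]; split=> [x h|a h]; rewrite ?r2 ?r1 ?m2 ?m1.
Qed.

Lemma frame_env k s s' : frame k s s' -> env s -> env s'.
Proof.
move=> [r h] [e1 e2 e3 e4 e5 e6]; split; rewrite ?r //.
- by move=> j lt_j; rewrite r ?e5 // /scratch; lia.
- move=> a lt_a; rewrite h ?e6 //; apply/negP => /andP[].
  by move: lt_a; rewrite /table_base; nia.
Qed.

Lemma frame_cell k k' s s' c : frame k s s' -> k' != k -> c < n * n ->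
  memory s' (table_base k' + c) = memory s (table_base k' + c).
Proof.
move=> [_ h] nk lt_c; rewrite h // /table_base; apply/negP => /andP[].
by case: (ltngtP k' k) nk => // lt_k _; nia.
Qed.

Lemma base_cell_lt k c : k < 12 -> c < n * n -> table_base k + c < space_limit.
Proof. by rewrite /space_limit /table_base; nia. Qed.

Lemma reads_tab s k a : env s -> k < 12 -> reads_ok s a -> eval s a < n * n ->
  reads_ok s (tab k a).
Proof.
move=> E k12 ra lt_a; split; first by split.
by rewrite [eval _ _](_ : _ = table_base k + eval s a) ?base_cell_lt //= (env_base E).
Qed.

Lemma eval_tab s k a : env s -> k < 12 ->
  eval s (tab k a) = memory s (table_base k + eval s a).
Proof. by move=> E k12; rewrite /tab [LHS]/= (env_base E). Qed.

(** Register 6 carries a left fold over [xs], the edges or the vertices, and [agg c pre] is its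
    value for cell [c] after the prefix [pre]. The 130 covers an expression of size 120 and the loop
    overhead 6; the 200 covers [e0], the decoding of the cell and the write. *)
Lemma wp_stage (T : Type) (xs : seq T) (agg : nat -> seq T -> nat)
    k lreg creg len e0 e s :
  env s -> k < 12 -> len <= n * n -> size xs <= word_limit ->
  ~~ scratch lreg -> ~~ scratch creg -> regs s lreg = len ->
  regs s creg = size xs -> adm e0 -> adm e ->
  (forall c pre, size pre <= size xs -> agg c pre <= word_limit) ->
  (forall c s1, c < len -> frame k s s1 -> regs s1 4 = c ->
     regs s1 7 = c %/ n -> regs s1 8 = c %% n ->
     reads_ok s1 e0 /\ eval s1 e0 = agg c [::]) ->
  (forall c pre x suf s1, c < len -> xs = pre ++ x :: suf -> frame k s s1 ->
     regs s1 4 = c -> regs s1 7 = c %/ n -> regs s1 8 = c %% n ->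
     regs s1 5 = size pre -> regs s1 6 = agg c pre ->
     reads_ok s1 e /\ eval s1 e = agg c (rcons pre x)) ->
  WP (stage k lreg creg e0 e) s (len * (size xs * 130 + 200) + 10) [::]
    (fun s' => frame k s s' /\ forall c, c < len -> memory s' (table_base k + c) = agg c xs).
Proof.
move=> E k12 le_len le_cnt sl sc rl rc ad0 ad agg_le H0 H1.
have ne x : ~~ scratch x -> [/\ (x == 4) = false, (x == 5) = false,
    (x == 6) = false, (x == 7) = false & (x == 8) = false].
  by rewrite /scratch => h; split; lia.
have /andP[_ es0] := ad0; have /andP[_ es] := ad.
have lenV : len <= word_limit.
  by rewrite /word_limit /table_base; move: le_len; nia.
pose Inv j s' := [/\ frame k s s', regs s' 4 = j &
  forall c, c < j -> memory s' (table_base k + c) = agg c xs].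
have Hreg j s' : j <= len /\ Inv j s' -> regs s' 4 = j /\ regs s' lreg = len.
  by case=> _ [[fr _] <- _]; rewrite (fr lreg).
rewrite /stage; set body := Seq (Assign 7 _) _.
have H : forall s', 0 <= len /\ Inv 0 s' ->
    WP (for_loop 4 lreg body) s' (len * (size xs * 126 + 136 + 6) + 3)
      (flatten [seq [::] | j <- iota 0 len]) (fun s' => len <= len /\ Inv len s').
  apply: (wp_for (o := fun=> [::]) (Inv := fun j s' => j <= len /\ Inv j s') _ lenV Hreg) => //.
  move=> j s1 lt_j [_ [fr1 r4 cells]].
  have E1 := frame_env fr1 E.
  refine (wp_weaken (t := _) (Q := _) _ _ (fun s' (q : _) => q)).
  - apply: wp_seq0; apply: wp_assign => //.
      by rewrite /= r4 (env_n E1) (leq_trans (leq_div _ _)) // ltnW // (leq_trans lt_j).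
    apply: wp_seq0; apply: wp_assign => //.
      by rewrite /= updE /= r4 (env_n E1) (leq_trans (leq_mod _ _)) // ltnW // (leq_trans lt_j).
    set s2 := set_reg _ 8 _.
    have fr2 : frame k s s2.
      apply: frame_trans fr1 _; split=> // x /ne[h4 h5 h6 h7 h8].
      by rewrite /s2 /= !updE h7 h8.
    have r27 : regs s2 7 = j %/ n by rewrite /s2 /= /upd /= r4 (env_n E1).
    have r28 : regs s2 8 = j %% n by rewrite /s2 /= /upd /= r4 (env_n E1).
    have [ra0 ea0] := H0 j s2 lt_j fr2 r4 r27 r28.
    apply: wp_seq0; apply: wp_assign => //.
      by rewrite ea0 agg_le.
    apply: wp_seq0; apply: wp_assign => //.
    rewrite ea0; set s3 := set_reg _ 5 _.
    pose Inv2 i s' := [/\ frame k s s', [/\ regs s' 4 = j, regs s' 7 = j %/ n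
      & regs s' 8 = j %% n], regs s' 5 = i /\ regs s' 6 = agg j (take i xs)
      & i <= size xs /\ memory s' =1 memory s1].
    have Hreg2 i s' : Inv2 i s' -> regs s' 5 = i /\ regs s' creg = size xs.
      by case=> [[fr _] _ [<- _] _]; rewrite (fr creg).
    have I3 : Inv2 0 s3.
      split; rewrite /s3 //= ?take0 //.
      apply: frame_trans fr2 _; split=> // x /ne[h4 h5 h6 h7 h8].
      by rewrite /= !updE h5 h6.
    have Hbody i s' : i < size xs -> Inv2 i s' -> WP (Assign 6 e) s' (esize e) [::]
        (fun s'' => regs s'' 5 = i /\ Inv2 i.+1 (set_reg s'' 5 i.+1)).
      move=> lt_i [fr' [h4 h7 h8] [h5 h6] [_ hm]].
      case Exs : (drop i xs) => [|x suf].
        by have := size_drop i xs; rewrite Exs /=; lia.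
      have xsE : xs = take i xs ++ x :: suf by rewrite -Exs cat_take_drop.
      have takeE : take i.+1 xs = rcons (take i xs) x.
        by rewrite -addn1 takeD Exs /= take0 cats1.
      have szi : size (take i xs) = i by rewrite size_takel // ltnW.
      have [ra ea] := H1 j (take i xs) x suf s' lt_j xsE fr' h4 h7 h8
        (etrans h5 (esym szi)) h6.
      apply: wp_assign => //; first by rewrite ea agg_le // size_rcons szi.
      split=> //; split; last by split.
      - apply: frame_trans fr' _; split=> // y /ne[k4 k5 k6 k7 k8].
        by rewrite /= !updE k5 k6.
      - by split.
      - by rewrite /= /upd /= ea takeE.
    have loop2 := wp_for (o := fun=> [::]) (erefl : 2 < expr_limit) le_cnt Hreg2 Hbody I3.
    rewrite (_ : flatten _ = [::]) in loop2; last by elim: (iota _ _).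
    apply: wp_seq0; apply: (wp_weaken loop2 (leqnn _)).
    move=> s4 [fr4 [h4 h7 h8] [h5 h6] [_ hm]].
    rewrite take_size in h6.
    have addrE : eval s4 (Bin Add (Reg (10 + k)) (Reg 4)) = table_base k + j.
      by rewrite [LHS]/= h4 (env_base (frame_env fr4 E)).
    have lt_jn := leq_trans lt_j le_len.
    apply: wp_write => //.
    - by rewrite addrE base_cell_lt.
    - by rewrite /= h6 agg_le.
    rewrite addrE [eval _ _]/= h6; split; rewrite //= ?h4 //.
    split=> //; split=> //=.
    - apply: frame_trans fr4 _; split=> [y /ne[k4 _ _ _ _]|y hy].
        by rewrite /= updE k4.
      rewrite /= updE; case: eqP hy => // ->; rewrite /table_base mulSn; lia.
    - move=> c lt_c; rewrite updE eqn_add2l; case: eqP => [->//|/eqP ncj].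
      by rewrite hm cells //; lia.
    have := leq_mul (leqnn (size xs)) (leq_add es (leqnn 6)).
    by move: es0; rewrite /= /expr_limit; lia.
rewrite (_ : flatten _ = [::]) in H; last by elim: (iota _ _).
refine (wp_weaken (t := _) (Q := fun s' => len <= len /\ Inv len s') _ _ _).
- apply: wp_seq0; apply: wp_assign => //; apply: H; split=> //; split=> //.
  split=> // x /ne[k4 _ _ _ _]; by rewrite /= updE k4.
- by rewrite /=; nia.
by move=> s' [_ [fr _ cells]].
Qed.

End Layout.

(** * The tables of the algorithm *)

Definition Not a := Bin Defs.Sub (Const 1) a.
Definition And a b := Bin Mul a b.
Definition Or a b := Bin Ltb (Const 0) (Bin Add a b).
Definition Eq a b := Bin Eqb a b.
Definition idx a b := Bin Add (Bin Mul a (Reg 0)) b.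
(* The endpoints of edge number reg 5. *)
Definition end1 := Read (Bin Add (Const 2) (Bin Add (Reg 5) (Reg 5))).
Definition end2 :=
  Read (Bin Add (Const 1) (Bin Add (Const 2) (Bin Add (Reg 5) (Reg 5)))).

(* Table 0 is adjacency, 1 is non-inclusion of closed neighbourhoods, 2 is [RN],
   3 is table 1 restricted to irredundant elements, 4 is the current set [A], and
   5 to 11 are recomputed for each test of [A] (11 is the vertex to remove). *)
Definition adj_stage := stage 0 2 1 (Eq (Reg 7) (Reg 8))
  (Or (Reg 6)
    (Or (And (Eq end1 (Reg 7)) (Eq end2 (Reg 8)))
        (And (Eq end2 (Reg 7)) (Eq end1 (Reg 8))))).

(** The vertices of [N u] selected by [F] escape [N v] through [u] itself or through the far end of
    an edge at [u]. Scanning edges gives [n ^ 2 * m]; scanning vertices would give [n ^ 3], too much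
    if [m < n]. *)
Definition subset_stage k (F : expr -> expr) :=
  stage k 2 1 (And (F (Reg 7)) (Not (tab 0 (idx (Reg 7) (Reg 8)))))
  (Or (Reg 6)
    (Or (And (Eq end1 (Reg 7)) (And (F end2) (Not (tab 0 (idx end2 (Reg 8))))))
        (And (Eq end2 (Reg 7)) (And (F end1) (Not (tab 0 (idx end1 (Reg 8)))))))).

Definition redundant_stage := stage 2 0 0 (Const 0)
  (Or (Reg 6)
    (And (Not (tab 1 (idx (Reg 5) (Reg 8))))
         (Not (And (Not (tab 1 (idx (Reg 8) (Reg 5))))
                   (Not (Bin Ltb (Reg 5) (Reg 8))))))).

Definition ndom_stage := stage 5 0 0 (Const 0)
  (Bin Add (Reg 6) (And (tab 0 (idx (Reg 8) (Reg 5))) (tab 4 (Reg 5)))).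

Definition bad_stage := stage 6 0 0 (Const 0)
  (Or (Reg 6)
    (And (Not (tab 2 (Reg 5)))
         (And (Eq (tab 5 (Reg 5)) (Const 0))
              (Not (tab 3 (idx (Reg 5) (Reg 8))))))).

Definition okp_stage := stage 7 0 0 (Const 0)
  (Or (Reg 6)
    (And (Not (tab 2 (Reg 5)))
         (And (Eq (tab 5 (Reg 5)) (Const 1))
              (And (tab 0 (idx (Reg 8) (Reg 5))) (Not (tab 6 (Reg 5))))))).

Definition okw_stage := stage 8 0 0 (Const 0)
  (Or (Reg 6)
    (And (Not (tab 2 (Reg 5)))
         (And (Eq (tab 5 (Reg 5)) (Const 1))
              (Not (tab 1 (idx (Reg 5) (Reg 8))))))).

Definition fail_stage := stage 9 3 0 (Const 0)
  (Or (Reg 6) (And (tab 4 (Reg 5)) (Not (tab 7 (Reg 5))))).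

(** Register 6 equals register 5 exactly as long as nothing has been found, so it is result and flag
    at once; it ends at [n] without a hit. *)
Definition find_stage k c := stage k 3 0 (Const 0)
  (Bin Add (Reg 6) (And (Eq (Reg 6) (Reg 5)) (Not c))).

Definition weak_stage :=
  find_stage 10 (And (tab 4 (Reg 5)) (Not (tab 8 (Reg 5)))).

(** The value [n] in table 10 signals that [Lset] is empty. *)
Definition removed_stage :=
  find_stage 11 (And (tab 4 (Reg 5))
    (Or (Eq (tab 10 (Const 0)) (Reg 0)) (Not (tab 8 (Reg 5))))).

Definition check :=
  Seq ndom_stage (Seq bad_stage (Seq okp_stage (Seq okw_stage
    (Seq fail_stage (Seq weak_stage removed_stage))))).

(** * Correctness of the tables *)

Section Tables.
Variables (n : nat) (e : rel 'I_n) (es : seq ('I_n * 'I_n)).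
Hypotheses (e_sym : symmetric e) (e_irr : irreflexive e) (ees : edge_list e es).

Notation m := (size es).
Notation inp := (nth 0 (encode es)).

Notation N := (clnbh e).
Notation RN := (RN e).
Notation base := (table_base n m).
Notation vmax := (word_limit n m).
Notation smax := (space_limit n m).
Notation WP := (wp vmax smax expr_limit).
Notation reads_ok := (reads_below smax).
Notation env := (env n m inp).
Notation frame := (frame n m).

Lemma inp_end1 pre x suf : es = pre ++ x :: suf ->
  inp (2 + (size pre + size pre)) = x.1 /\
  inp (1 + (2 + (size pre + size pre))) = x.2.
Proof.
move=> esE; rewrite /encode esE map_cat flatten_cat /= !nth_cat.
rewrite (_ : size (flatten _) = size pre + size pre) ?ltnn ?subnn //.
  by rewrite ltnNge leqW //= subSn // subnn.
elim: pre {esE} => //= p pre ->; lia.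
Qed.

Lemma enum_ord_split pre x suf : enum 'I_n = pre ++ x :: suf -> size pre = x.
Proof.
move=> E; have lt : size pre < n.
  by have := size_enum_ord n; rewrite E size_cat /=; lia.
by rewrite -[LHS](nth_enum_ord x lt) E nth_cat ltnn subnn.
Qed.

(** Safe reads and value in one judgement, so that an expression is matched with a Boolean formula
    along its syntax. *)
Definition rv s a v := reads_ok s a /\ eval s a = v.

Lemma rv_reg s x v : regs s x = v -> rv s (Reg x) v. Proof. by []. Qed.

Lemma rv_bin s o a b x y : rv s a x -> rv s b y ->
  rv s (Bin o a b) (eval_binop o x y).
Proof. by case=> ra <- [rb <-]. Qed.

Lemma rv_not s a (b : bool) : rv s a b -> rv s (Not a) (~~ b).
Proof. by case=> ra ea; split=> //=; rewrite ea; case: b {ea}. Qed.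

Lemma rv_and s a b (x y : bool) : rv s a x -> rv s b y -> rv s (And a b) (x && y).
Proof. by case=> ra ea [rb eb]; split=> //=; rewrite ea eb mulnb. Qed.

Lemma rv_or s a b (x y : bool) : rv s a x -> rv s b y -> rv s (Or a b) (x || y).
Proof. by case=> ra ea [rb eb]; split=> //=; rewrite ea eb; case: x y {ea eb} => [] []. Qed.

Lemma rv_eq s a b x y : rv s a x -> rv s b y -> rv s (Eq a b) (x == y).
Proof. exact: rv_bin. Qed.

Lemma rv_eqo s a b (x y : 'I_n) : rv s a x -> rv s b y -> rv s (Eq a b) (x == y).
Proof. exact: rv_bin. Qed.

Definition vec s k (f : 'I_n -> nat) := forall v : 'I_n, memory s (base k + v) = f v.

Definition mat s k (f : 'I_n -> 'I_n -> nat) :=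
  forall u v : 'I_n, memory s (base k + (u * n + v)) = f u v.

Lemma ord_lt_sq (u : 'I_n) : u < n * n.
Proof. by have := ltn_ord u; nia. Qed.

Lemma cell_lt (u v : 'I_n) : u * n + v < n * n.
Proof. by have := ltn_ord u; have := ltn_ord v; nia. Qed.

Lemma rv_vec s k f a v : env s -> vec s k f -> k < 12 -> rv s a (val v) ->
  rv s (tab k a) (f v).
Proof.
move=> E Hv k12 [ra ea]; split; last by rewrite (eval_tab _ E) // ea Hv.
by apply: (reads_tab E) => //; rewrite ea ord_lt_sq.
Qed.

Lemma rv_mat s k f a b u v : env s -> mat s k f -> k < 12 ->
  rv s a (val u) -> rv s b (val v) -> rv s (tab k (idx a b)) (f u v).
Proof.
move=> E Hm k12 [ra ea] [rb eb].
have ei : eval s (idx a b) = u * n + v by rewrite /= ea eb (env_n E).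
split; last by rewrite (eval_tab _ E) // ei Hm.
by apply: (reads_tab E) => //; rewrite ei cell_lt.
Qed.

Lemma rv_end s pre x suf : env s -> es = pre ++ x :: suf ->
  regs s 5 = size pre -> rv s end1 (val x.1) /\ rv s end2 (val x.2).
Proof.
move=> E esE r5; have [h1 h2] := inp_end1 esE.
have lt : size pre < m by rewrite esE size_cat /= addnS ltnS leq_addr.
have lt2 : 1 + (2 + (size pre + size pre)) < base 0 by rewrite /table_base; lia.
have lt1 : 2 + (size pre + size pre) < base 0 by rewrite /table_base; lia.
have le0 : base 0 <= smax by rewrite /table_base /space_limit /table_base; lia.
by split; (split=> /=; rewrite r5; [split=> //; apply: leq_trans le0|rewrite (env_inp E)]).
Qed.

Lemma vec_frame k k' s s' f : frame k s s' -> k' != k -> vec s k' f -> vec s' k' f.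
Proof. by move=> fr nk H v; rewrite (frame_cell fr) ?ord_lt_sq. Qed.

Lemma mat_frame k k' s s' f : frame k s s' -> k' != k -> mat s k' f -> mat s' k' f.
Proof. by move=> fr nk H u v; rewrite (frame_cell fr) ?cell_lt. Qed.

Lemma wp_mat_stage (agg : 'I_n -> 'I_n -> seq ('I_n * 'I_n) -> bool) k e0 e1 s :
  env s -> k < 12 -> admissible expr_limit e0 -> admissible expr_limit e1 ->
  (forall u v s1, frame k s s1 -> env s1 -> regs s1 7 = val u -> regs s1 8 = val v ->
     rv s1 e0 (agg u v [::])) ->
  (forall u v pre x suf s1, es = pre ++ x :: suf -> frame k s s1 -> env s1 ->
     regs s1 7 = val u -> regs s1 8 = val v ->
     rv s1 end1 (val x.1) -> rv s1 end2 (val x.2) -> rv s1 (Reg 6) (agg u v pre) ->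
     rv s1 e1 (agg u v (rcons pre x))) ->
  WP (stage k 2 1 e0 e1) s (n * n * (m * 130 + 200) + 10) [::]
    (fun s' => frame k s s' /\ mat s' k (fun u v => agg u v es)).
Proof.
move=> E k12 ad0 ad1 H0 H1.
(* Cells are decoded into pairs of vertices; the default 0 is never met for [c < n * n]. *)
pose agg' c pre : nat := if insub (c %/ n) is Some u then
  if insub (c %% n) is Some v then agg u v pre else 0 else 0.
have dv (u v : 'I_n) : (u * n + v) %/ n = u /\ (u * n + v) %% n = v.
  have n0 : 0 < n by rewrite (leq_ltn_trans _ (ltn_ord u)).
  by rewrite divnMDl // modnMDl (divn_small (ltn_ord v)) addn0 modn_small.
have aggE u v pre : agg' (val u * n + val v) pre = agg u v pre.
  by rewrite /agg'; have [-> ->] := dv u v; rewrite !valK.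
have ex c : c < n * n -> exists u v : 'I_n, c = val u * n + val v.
  move=> lt_c; have n0 : 0 < n by lia.
  have lt_u : c %/ n < n by rewrite ltn_divLR.
  exists (Ordinal lt_u), (Ordinal (ltn_pmod c n0)) => /=.
  exact: divn_eq.
apply: wp_weaken (_ : WP _ s _ _ _) (leqnn _) _.
  apply: (@wp_stage n m inp _ es agg' k 2 1 (n * n)) => //.
  - by rewrite /word_limit /table_base; lia.
  - exact: (env_nn E).
  - exact: (env_m E).
  - rewrite /agg' => c pre _; case: insub => // u; case: insub => // v.
    by case: (agg _ _ _) => //; rewrite /word_limit; lia.
  - move=> c s1 /ex[u [v ->]] fr _; have [-> ->] := dv u v => h7 h8.
    by rewrite aggE; apply: H0 => //; apply: frame_env fr E.
  move=> c pre x suf s1 /ex[u [v ->]] esE fr _; have [-> ->] := dv u v => h7 h8 h5 h6.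
  have E1 := frame_env fr E; have [r1 r2] := rv_end E1 esE h5.
  rewrite aggE; apply: (H1 u v pre x suf) => //.
  by rewrite -aggE; apply: rv_reg.
move=> s' [fr cells]; split=> // u v.
by rewrite cells ?cell_lt // aggE.
Qed.

Lemma wp_vec_stage (agg : 'I_n -> seq 'I_n -> nat) k e0 e1 s :
  env s -> k < 12 -> admissible expr_limit e0 -> admissible expr_limit e1 ->
  (forall v pre, size pre <= n -> agg v pre <= vmax) ->
  (forall v s1, frame k s s1 -> env s1 -> regs s1 8 = val v ->
     rv s1 e0 (agg v [::])) ->
  (forall v pre (x : 'I_n) s1, size pre = x -> frame k s s1 -> env s1 ->
     regs s1 8 = val v -> regs s1 5 = val x -> rv s1 (Reg 6) (agg v pre) ->
     rv s1 e1 (agg v (rcons pre x))) ->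
  WP (stage k 0 0 e0 e1) s (n * (n * 130 + 200) + 10) [::]
    (fun s' => frame k s s' /\ vec s' k (fun v => agg v (enum 'I_n))).
Proof.
move=> E k12 ad0 ad1 agg_le H0 H1.
pose agg' c pre := if insub c is Some v then agg v pre else 0.
have aggE (v : 'I_n) pre : agg' v pre = agg v pre by rewrite /agg' valK.
apply: wp_weaken (_ : WP _ s (n * (size (enum 'I_n) * 130 + 200) + 10) _ _) _ _.
- apply: (@wp_stage n m inp _ (enum 'I_n) agg' k 0 0 n) => //.
  + by case: (n) => // ?; rewrite leq_pmulr.
  + by rewrite size_enum_ord /word_limit; lia.
  + exact: (env_n E).
  + by rewrite (env_n E) size_enum_ord.
  + by rewrite /agg' size_enum_ord => c pre le_n; case: insub => // v; apply: agg_le.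
  + move=> c s1 lt_c fr _ _; rewrite modn_small // => h8.
    rewrite (aggE (Ordinal lt_c)); apply: H0 => //; exact: frame_env fr E.
  move=> c pre x suf s1 lt_c /enum_ord_split szE fr _ _.
  rewrite modn_small // => h8 h5 h6.
  rewrite (aggE (Ordinal lt_c)); apply: H1 => //; first exact: frame_env fr E.
  - by rewrite h5.
  by rewrite -(aggE (Ordinal lt_c)); apply: rv_reg.
- by rewrite size_enum_ord.
by move=> s' [fr cells]; split=> // v; rewrite cells // aggE.
Qed.

Lemma wp_cell_stage (agg : seq 'I_n -> nat) k e0 e1 s :
  0 < n ->
  env s -> k < 12 -> admissible expr_limit e0 -> admissible expr_limit e1 ->
  (forall pre, size pre <= n -> agg pre <= vmax) ->
  (forall s1, frame k s s1 -> env s1 -> rv s1 e0 (agg [::])) ->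
  (forall pre (x : 'I_n) s1, size pre = x -> frame k s s1 -> env s1 ->
     regs s1 5 = val x -> rv s1 (Reg 6) (agg pre) ->
     rv s1 e1 (agg (rcons pre x))) ->
  WP (stage k 3 0 e0 e1) s (n * 130 + 200 + 10) [::]
    (fun s' => frame k s s' /\ memory s' (base k) = agg (enum 'I_n)).
Proof.
move=> n0 E k12 ad0 ad1 agg_le H0 H1.
apply: wp_weaken (_ : WP _ s (1 * (size (enum 'I_n) * 130 + 200) + 10) _ _) _ _.
- apply: (@wp_stage n m inp _ (enum 'I_n) (fun=> agg) k 3 0 1) => //.
  + by nia.
  + by rewrite size_enum_ord /word_limit; lia.
  + exact: (env_one E).
  + by rewrite (env_n E) size_enum_ord.
  + by rewrite size_enum_ord => _ pre; apply: agg_le.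
  + by move=> c s1 _ fr _ _ _; apply: H0 => //; apply: frame_env fr E.
  move=> c pre x suf s1 _ /enum_ord_split szE fr _ _ _ h5 h6.
  by apply: H1 => //; [apply: frame_env fr E | rewrite h5].
- by rewrite size_enum_ord mul1n.
by move=> s' [fr cells]; split=> //; rewrite -(cells 0) ?addn0.
Qed.

Lemma edge_es x y : (x, y) \in es -> e x y.
Proof.
rewrite -has_pred1 has_count => c0; have := ees x y; case: (e x y) => // /eqP.
by rewrite addn_eq0 eqn0Ngt c0.
Qed.

Lemma adj_es u v : (v \in N u) = (u == v) ||
  has (fun p => (p.1 == u) && (p.2 == v) || (p.2 == u) && (p.1 == v)) es.
Proof.
rewrite mem_clnbh eq_sym; congr (_ || _); apply/idP/hasP => [euv|[[x y] /= xy]].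
  have : 0 < count_mem (u, v) es + count_mem (v, u) es by rewrite ees euv.
  rewrite addn_gt0 -!has_count !has_pred1 => /orP[] h.
    by exists (u, v); rewrite //= !eqxx.
  by exists (v, u); rewrite //= !eqxx orbT.
have exy := edge_es xy.
by case/orP=> /andP[/eqP<- /eqP<-] //; rewrite e_sym.
Qed.

Lemma wp_adj s : env s ->
  WP adj_stage s (n * n * (m * 130 + 200) + 10) [::]
    (fun s' => frame 0 s s' /\ mat s' 0 (fun u v => v \in N u)).
Proof.
move=> E; apply: wp_weaken (leqnn _) _.
  apply: (wp_mat_stage (agg := fun u v pre => (u == v) ||
    has (fun p => (p.1 == u) && (p.2 == v) || (p.2 == u) && (p.1 == v)) pre)) => //.
  - by move=> u v s1 _ _ h7 h8; rewrite orbF; apply: rv_eqo; apply: rv_reg.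
  move=> u v pre x suf s1 _ _ _ h7 h8 h1 h2 h6.
  rewrite has_rcons orbCA orbC; apply: rv_or h6 _.
  by apply: rv_or; apply: rv_and; apply: rv_eqo.
by move=> s' [fr h]; split=> // u v; rewrite h -adj_es.
Qed.

Lemma wp_subset k F (P : pred 'I_n) s : env s -> k < 12 -> 0 != k ->
  mat s 0 (fun u v => v \in N u) ->
  (forall a, esize (F a) <= esize a + 20) ->
  (forall a, small_consts a -> small_consts (F a)) ->
  (forall s1 a (v : 'I_n), frame k s s1 -> env s1 -> rv s1 a (val v) ->
     rv s1 (F a) (P v)) ->
  WP (subset_stage k F) s (n * n * (m * 130 + 200) + 10) [::]
    (fun s' => frame k s s' /\
       mat s' k (fun u v => ~~ ([set y in N u | P y] \subset N v))).
Proof.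
move=> E k12 k0 M0 Fs Fc HF.
pose Q u v (p : 'I_n * 'I_n) := (p.1 == u) && (P p.2 && (v \notin N p.2)) ||
  (p.2 == u) && (P p.1 && (v \notin N p.1)).
apply: wp_weaken (leqnn _) _.
  apply: (wp_mat_stage (agg := fun u v pre => (P u && (v \notin N u)) ||
    has (Q u v) pre)) => //.
  - rewrite /admissible /= !Fc // (leq_trans _ (_ : 40 <= expr_limit)) //.
    by have := Fs (Reg 7); rewrite /=; lia.
  - rewrite /admissible /= !Fc //=.
    by have := Fs end1; have := Fs end2; rewrite /= /expr_limit; lia.
  - move=> u v s1 fr E1 h7 h8; rewrite orbF; apply: rv_and; first exact: HF.
    apply: rv_not; apply: (rv_mat (f := fun u v => v \in N u)) => //.
    exact: mat_frame fr k0 M0.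
  move=> u v pre x suf s1 _ fr E1 h7 h8 h1 h2 h6.
  have M1 := mat_frame fr k0 M0.
  rewrite has_rcons orbCA orbC; apply: rv_or h6 _.
  apply: rv_or; (apply: rv_and; first exact: rv_eqo);
    (apply: rv_and; first exact: HF);
    apply: rv_not; apply: (rv_mat (f := fun u v => v \in N u)) => //; exact: M1.
move=> s' [fr h]; split=> // u v; rewrite h; congr (nat_of_bool _).
apply/idP/subsetPn => [/orP[/andP[Pu nuv]|/hasP[[x y] /edge_es xy]]|[y]].
- by exists u; [rewrite in_set clnbh_refl | rewrite clnbh_sym].
- case/orP=> /= /and3P[/eqP<- Pz nz].
    by exists y; [rewrite in_set mem_clnbh xy orbT | rewrite clnbh_sym].
  by exists x; [rewrite in_set mem_clnbh e_sym xy orbT | rewrite clnbh_sym].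
rewrite in_set => /andP[yu Py] ny; rewrite clnbh_sym // in ny.
have := yu; rewrite adj_es => /orP[/eqP->|/hasP[[z w] zw /= zwE]]; first by rewrite Py ny.
apply/orP; right; apply/hasP; exists (z, w) => //; rewrite /Q /=.
by case/orP: zwE => /andP[/eqP<- /eqP yE]; rewrite yE Py ny eqxx ?orbT.
Qed.


(** These tables depend on the graph alone and are filled once. *)
Definition static s :=
  [/\ env s, mat s 0 (fun u v => v \in N u),
      mat s 1 (fun u v => ~~ (N u \subset N v)), vec s 2 (fun v => v \in RN)
    & mat s 3 (fun u v => ~~ (N u :\: RN \subset N v))].

Lemma static_frame k s s' : 3 < k -> frame k s s' -> static s -> static s'.
Proof.
move=> k3 fr [E m0 m1 v2 m3]; split.
- exact: frame_env fr E.
- by apply: mat_frame fr _ m0; lia.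
- by apply: mat_frame fr _ m1; lia.
- by apply: vec_frame fr _ v2; lia.
by apply: mat_frame fr _ m3; lia.
Qed.

Lemma has_enum (P : pred 'I_n) : has P (enum 'I_n) = [exists x, P x].
Proof.
apply/hasP/existsP => [[x _ Px]|[x Px]]; first by exists x.
by exists x; rewrite ?mem_enum.
Qed.

Lemma wp_redundant s : env s -> mat s 1 (fun u v => ~~ (N u \subset N v)) ->
  WP redundant_stage s (n * (n * 130 + 200) + 10) [::]
    (fun s' => frame 2 s s' /\ vec s' 2 (fun v => v \in RN)).
Proof.
move=> E m1; apply: wp_weaken (leqnn _) _.
  (* The double negations mirror the program, as table 1 stores non-inclusion. *)
  apply: (wp_vec_stage (agg := fun v pre =>
    has (fun y => ~~ ~~ (N y \subset N v) && ~~ (~~ ~~ (N v \subset N y) && ~~ (y < v)))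
      pre)) => //.
    by move=> v pre _; case: has => //; rewrite /word_limit; lia.
  move=> v pre y s1 _ fr E1 h8 h5 h6; have m1' := mat_frame fr (isT : 1 != 2) m1.
  rewrite has_rcons orbC; apply: rv_or h6 _; apply: rv_and.
    by apply: rv_not; apply: (rv_mat E1 m1' isT).
  apply: rv_not; apply: rv_and; first by apply: rv_not; apply: (rv_mat E1 m1' isT).
  by apply: rv_not; apply: rv_bin.
move=> s' [fr h]; split=> // v; rewrite h has_enum mem_RN; congr (nat_of_bool _).
by apply: eq_existsb => y; rewrite !negbK -leqNgt.
Qed.

(** * The membership test and the vertex to remove *)

Section Check.
Variable A : {set 'I_n}.

Notation memA s := (vec s 4 (fun v => v \in A)).

Lemma ndom_count v : ndom e A v = count (fun a => (a \in N v) && (a \in A)) (enum 'I_n).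
Proof.
rewrite /ndom cardE -size_filter /(enum (mem (N v :&: A))) -enumT.
by congr (size _); apply: eq_filter => a; rewrite /= in_setI.
Qed.

Lemma wp_ndom s : static s -> memA s ->
  WP ndom_stage s (n * (n * 130 + 200) + 10) [::]
    (fun s' => frame 5 s s' /\ vec s' 5 (ndom e A)).
Proof.
move=> [E m0 _ _ _] v4; apply: wp_weaken (leqnn _) _.
  apply: (wp_vec_stage (agg := fun v pre =>
    count (fun a => (a \in N v) && (a \in A)) pre)) => //.
    move=> v pre le_n; apply: leq_trans (count_size _ _) _.
    by apply: leq_trans le_n _; rewrite /word_limit; lia.
  move=> v pre a s1 _ fr E1 h8 h5 h6.
  have m0' := mat_frame fr (isT : 0 != 5) m0.
  have v4' := vec_frame fr (isT : 4 != 5) v4.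
  rewrite -cats1 count_cat /= addn0; apply: rv_bin h6 _; apply: rv_and.
    exact: (rv_mat E1 m0' isT).
  exact: (rv_vec E1 v4' isT).
by move=> s' [fr h]; split=> // v; rewrite h ndom_count.
Qed.

Lemma wp_bad s : static s -> vec s 5 (ndom e A) ->
  WP bad_stage s (n * (n * 130 + 200) + 10) [::]
    (fun s' => frame 6 s s' /\ vec s' 6 (bad e A)).
Proof.
move=> [E _ _ v2 m3] v5; apply: wp_weaken (leqnn _) _.
  apply: (wp_vec_stage (agg := fun v pre =>
    has (fun u => [&& u \notin RN, ndom e A u == 0 & ~~ ~~ (N u :\: RN \subset N v)])
      pre)) => //.
    by move=> v pre _; case: has => //; rewrite /word_limit; lia.
  move=> v pre u s1 _ fr E1 h8 h5 h6.
  have v2' := vec_frame fr (isT : 2 != 6) v2.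
  have m3' := mat_frame fr (isT : 3 != 6) m3.
  have v5' := vec_frame fr (isT : 5 != 6) v5.
  rewrite has_rcons orbC; apply: rv_or h6 _; apply: rv_and.
    apply: rv_not; exact: (rv_vec E1 v2' isT).
  apply: rv_and; last by apply: rv_not; apply: (rv_mat E1 m3' isT).
  by apply: rv_eq => //; apply: (rv_vec E1 v5' isT).
move=> s' [fr h]; split=> // v; rewrite h has_enum; congr (nat_of_bool _).
by apply: eq_existsb => y; rewrite !negbK.
Qed.

Lemma wp_okp s : static s -> vec s 5 (ndom e A) -> vec s 6 (bad e A) ->
  WP okp_stage s (n * (n * 130 + 200) + 10) [::]
    (fun s' => frame 7 s s' /\ vec s' 7 (okp e A)).
Proof.
move=> [E m0 _ v2 _] v5 v6; apply: wp_weaken (leqnn _) _.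
  apply: (wp_vec_stage (agg := fun v pre =>
    has (fun p => [&& p \notin RN, ndom e A p == 1, p \in N v & ~~ bad e A p]) pre)) => //.
    by move=> v pre _; case: has => //; rewrite /word_limit; lia.
  move=> v pre u s1 _ fr E1 h8 h5 h6.
  have m0' := mat_frame fr (isT : 0 != 7) m0.
  have v2' := vec_frame fr (isT : 2 != 7) v2.
  have v5' := vec_frame fr (isT : 5 != 7) v5.
  have v6' := vec_frame fr (isT : 6 != 7) v6.
  rewrite has_rcons orbC; apply: rv_or h6 _; apply: rv_and.
    apply: rv_not; exact: (rv_vec E1 v2' isT).
  apply: rv_and; first by apply: rv_eq => //; apply: (rv_vec E1 v5' isT).
  apply: rv_and; first exact: (rv_mat E1 m0' isT).
  apply: rv_not; exact: (rv_vec E1 v6' isT).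
by move=> s' [fr h]; split=> // v; rewrite h has_enum.
Qed.

Lemma wp_okw s : static s -> vec s 5 (ndom e A) ->
  WP okw_stage s (n * (n * 130 + 200) + 10) [::]
    (fun s' => frame 8 s s' /\ vec s' 8 (okw e A)).
Proof.
move=> [E _ m1 v2 _] v5; apply: wp_weaken (leqnn _) _.
  apply: (wp_vec_stage (agg := fun v pre =>
    has (fun p => [&& p \notin RN, ndom e A p == 1 & ~~ ~~ (N p \subset N v)]) pre)) => //.
    by move=> v pre _; case: has => //; rewrite /word_limit; lia.
  move=> v pre u s1 _ fr E1 h8 h5 h6.
  have m1' := mat_frame fr (isT : 1 != 8) m1.
  have v2' := vec_frame fr (isT : 2 != 8) v2.
  have v5' := vec_frame fr (isT : 5 != 8) v5.
  rewrite has_rcons orbC; apply: rv_or h6 _; apply: rv_and.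
    apply: rv_not; exact: (rv_vec E1 v2' isT).
  apply: rv_and; first by apply: rv_eq => //; apply: (rv_vec E1 v5' isT).
  apply: rv_not; exact: (rv_mat E1 m1' isT).
move=> s' [fr h]; split=> // v; rewrite h has_enum; congr (nat_of_bool _).
by apply: eq_existsb => y; rewrite !negbK.
Qed.

Lemma wp_fail s : 0 < n -> static s -> memA s -> vec s 7 (okp e A) ->
  WP fail_stage s (n * 130 + 200 + 10) [::]
    (fun s' => frame 9 s s' /\
       memory s' (base 9) = ~~ [forall a in A, okp e A a]).
Proof.
move=> n0 [E _ _ _ _] v4 v7; apply: wp_weaken (leqnn _) _.
  apply: (wp_cell_stage (agg := has (fun a => (a \in A) && ~~ okp e A a))) => //.
    by move=> pre _; case: has => //; rewrite /word_limit; lia.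
  move=> pre a s1 _ fr E1 h5 h6.
  have v4' := vec_frame fr (isT : 4 != 9) v4.
  have v7' := vec_frame fr (isT : 7 != 9) v7.
  rewrite has_rcons orbC; apply: rv_or h6 _; apply: rv_and.
    exact: (rv_vec E1 v4' isT).
  apply: rv_not; exact: (rv_vec E1 v7' isT).
by move=> s' [fr h]; split=> //; rewrite h has_enum negb_forall_in.
Qed.

Lemma find_rcons_index (T : Type) (P : pred T) s x :
  find P (rcons s x) = find P s + ((find P s == size s) && ~~ P x).
Proof.
rewrite -cats1 find_cat /= has_find; have := find_size P s.
by case: ltngtP => //= [|->] _; [rewrite addn0 | case: (P x); rewrite ?addn0 ?addn1].
Qed.

Lemma wp_find k c (P : pred 'I_n) s : 0 < n -> env s -> k < 12 ->
  small_consts c -> esize c <= 80 ->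
  (forall (a : 'I_n) s1, frame k s s1 -> env s1 -> regs s1 5 = a -> rv s1 c (P a)) ->
  WP (find_stage k c) s (n * 130 + 200 + 10) [::]
    (fun s' => frame k s s' /\ memory s' (base k) = find P (enum 'I_n)).
Proof.
move=> n0 E k12 sc ec Hc; apply: (wp_cell_stage (agg := find P)) => //.
- by rewrite /admissible /= sc /expr_limit /=; lia.
- move=> pre le_n; apply: leq_trans (find_size _ _) _.
  by apply: leq_trans le_n _; rewrite /word_limit; lia.
move=> pre a s1 szE fr E1 h5 h6; rewrite find_rcons_index.
apply: (rv_bin _ h6); apply: rv_and; last by apply: rv_not; apply: Hc.
by apply: rv_eq h6 _; rewrite szE.
Qed.

Lemma wp_weak s : 0 < n -> static s -> memA s -> vec s 8 (okw e A) ->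
  WP weak_stage s (n * 130 + 200 + 10) [::]
    (fun s' => frame 10 s s' /\
       memory s' (base 10) = find (mem (Lset e A)) (enum 'I_n)).
Proof.
move=> n0 [E _ _ _ _] v4 v8; apply: wp_find => // a s1 fr E1 h5.
have v4' := vec_frame fr (isT : 4 != 10) v4.
have v8' := vec_frame fr (isT : 8 != 10) v8.
rewrite [mem _ _]in_set; apply: rv_and; first exact: (rv_vec E1 v4' isT).
apply: rv_not; exact: (rv_vec E1 v8' isT).
Qed.

Lemma wp_removed s : 0 < n -> static s -> memA s -> vec s 8 (okw e A) ->
  memory s (base 10) = find (mem (Lset e A)) (enum 'I_n) ->
  WP removed_stage s (n * 130 + 200 + 10) [::]
    (fun s' => frame 11 s s' /\ memory s' (base 11) = removed e A).
Proof.
move=> n0 [E _ _ _ _] v4 v8 h10; apply: wp_find => // a s1 fr E1 h5.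
have v4' := vec_frame fr (isT : 4 != 11) v4.
have v8' := vec_frame fr (isT : 8 != 11) v8.
have n2 : 0 < n * n by rewrite muln_gt0 n0.
have h10' : memory s1 (base 10) = find (mem (Lset e A)) (enum 'I_n).
  by rewrite -(addn0 (base 10)) (frame_cell fr) // addn0.
have L0 : (Lset e A == set0) = (find (mem (Lset e A)) (enum 'I_n) == n).
  have := has_find (mem (Lset e A)) (enum 'I_n).
  have := find_size (mem (Lset e A)) (enum 'I_n).
  rewrite size_enum_ord leq_eqVlt has_enum => + hL.
  rewrite -hL => /orP[/eqP E'|h].
    move: hL; rewrite E' ltnn eqxx => hL; apply/eqP/setP => b; rewrite in_set0.
    by apply/negP => bL; move/existsP: hL; case; exists b.
  rewrite (negbTE (_ : _ != n)); last by move: hL; rewrite h ltn_neqAle => /esym/andP[].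
  by apply/negbTE/set0Pn; case/existsP: h => b bL; exists b.
have -> : mem (cand e A) a = (a \in A) &&
    ((find (mem (Lset e A)) (enum 'I_n) == n) || ~~ okw e A a).
  by rewrite [LHS]in_set L0 in_set; case: (a \in A).
apply: rv_and; first exact: (rv_vec E1 v4' isT).
apply: rv_or; last by apply: rv_not; apply: (rv_vec E1 v8' isT).
apply: rv_eq; last by apply: rv_reg; apply: (env_n E1).
split; last by rewrite (eval_tab _ E1) // addn0.
exact: (reads_tab E1).
Qed.
End Check.
End Tables.

(** * Delay *)

Section OneSolution.
Variables (V S K : nat).

(* As [wp], for runs that complete exactly one solution. *)
Definition wp_end c s t1 (out : seq nat) t2 (Q : state -> Prop) :=
  bounded V s -> exists tr1 tr2 s',
  [/\ exec c s (tr1 ++ EvEnd :: tr2) s',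
      all (silent_free V S K) tr1 /\ all (silent_free V S K) tr2,
      [/\ pmap printed tr1 = out, pmap printed tr2 = [::], size tr1 <= t1
        & size tr2 <= t2],
      bounded V s' & Q s'].

Lemma wp_end_weaken c s t1 t1' t2 t2' o (Q Q' : state -> Prop) :
  wp_end c s t1 o t2 Q -> t1 <= t1' -> t2 <= t2' -> (forall s', Q s' -> Q' s') ->
  wp_end c s t1' o t2' Q'.
Proof.
move=> H le1 le2 QQ /H[tr1 [tr2 [s' [ex ok [p1 p2 z1 z2] bs q]]]].
exists tr1, tr2, s'; split; [exact: ex|exact: ok| |exact: bs|exact: QQ].
by split=> //; [apply: leq_trans le1 | apply: leq_trans le2].
Qed.

Lemma wp_EndSol s (Q : state -> Prop) : Q s -> wp_end EndSol s 0 [::] 0 Q.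
Proof. by move=> q bs; exists [::], [::], s; split=> //; constructor. Qed.

Lemma wp_end_seql c1 c2 s t t1 o1 o2 t2 (Q : state -> Prop) :
  wp V S K c1 s t o1 (fun s1 => wp_end c2 s1 t1 o2 t2 Q) ->
  wp_end (Seq c1 c2) s (t + t1) (o1 ++ o2) t2 Q.
Proof.
move=> H /H[tr [s1 [ex ok [po st] bs1 H1]]].
have [tr1 [tr2 [s' [ex' [ok1 ok2] [p1 p2 z1 z2] bs q]]]] := H1 bs1.
exists (tr ++ tr1), tr2, s'; split=> //.
- by rewrite -catA; apply: ExecSeq ex ex'.
- by rewrite all_cat ok.
by rewrite pmap_cat po p1 size_cat leq_add.
Qed.

Lemma wp_end_seqr c1 c2 s t1 o t2 t (Q : state -> Prop) :
  wp_end c1 s t1 o t2 (fun s1 => wp V S K c2 s1 t [::] Q) ->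
  wp_end (Seq c1 c2) s t1 o (t2 + t) Q.
Proof.
move=> H /H[tr1 [tr2 [s1 [ex [ok1 ok2] [p1 p2 z1 z2] bs1 H1]]]].
have [tr [s' [ex' ok [po st] bs q]]] := H1 bs1.
exists tr1, (tr2 ++ tr), s'; split=> //.
- by rewrite -cat_cons catA; apply: ExecSeq ex ex'.
- by rewrite all_cat ok2.
by rewrite pmap_cat p2 po size_cat leq_add.
Qed.

Lemma wp_end_if a c1 c2 s t1 o t2 (Q : state -> Prop) :
  admissible K a -> reads_below S s a ->
  wp_end (if eval s a != 0 then c1 else c2) s t1 o t2 Q ->
  wp_end (If a c1 c2) s (esize a + t1) o t2 Q.
Proof.
move=> ad ra H bs; have [tr1 [tr2 [s' [ex [ok1 ok2] [p1 p2 z1 z2] bs' q]]]] := H bs.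
have [oka poa] := eval_trace_ok bs ad ra.
exists (eval_trace s a ++ tr1), tr2, s'; rewrite -catA; split=> //.
- by move: ex; case: ifPn => [a0|/negPn/eqP a0]; [apply: ExecIfTrue|apply: ExecIfFalse].
- by rewrite all_cat oka.
by rewrite pmap_cat poa size_cat size_eval_trace leq_add2l.
Qed.

Variable D : nat.

(** [D] bounds every segment, [k] only the first one, which is the segment that grows when
    operations are put in front. *)
Definition paced k (outs : seq (seq nat)) tr :=
  [/\ all (ev_ok V S K) tr, output tr = rcons outs [::],
      all (fun sg => size sg <= D) (segments tr) & size (head [::] (segments tr)) <= k].

Lemma segments_cons tr : exists sg sgs, segments tr = sg :: sgs.
Proof.
case: tr => [|ev tr]; first by exists [::], [::].
by case: ev => [v|a v|a v|v|] /=; do 2! eexists.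
Qed.

Lemma segments_cat tr1 tr2 : all (silent_free V S K) tr1 ->
  segments (tr1 ++ tr2) =
    (tr1 ++ head [::] (segments tr2)) :: behead (segments tr2).
Proof.
elim: tr1 => [|ev tr1 IH] /=.
  by have [sg [sgs ->]] := segments_cons tr2.
by case/andP=> ok /IH{}IH; case: ev ok => // *; rewrite IH.
Qed.

Lemma paced_silent k outs t tr1 tr2 : all (silent_free V S K) tr1 ->
  pmap printed tr1 = [::] -> size tr1 <= t -> t + k <= D ->
  paced k outs tr2 -> paced (t + k) outs (tr1 ++ tr2).
Proof.
move=> ok p1 z1 le_D [ok2]; rewrite /paced /output (segments_cat _ ok) all_cat.
have [sg [sgs ->]] := segments_cons tr2 => /= o2 /andP[_ d2] le_k.
rewrite ok2 pmap_cat p1 d2 !andbT size_cat leq_add //.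
rewrite (leq_trans _ le_D) ?leq_add //; split=> //.
by apply: sub_all ok => -[].
Qed.

Lemma paced_end k outs t tr1 tr2 : all (silent_free V S K) tr1 ->
  size tr1 < t -> t <= D -> paced k outs tr2 ->
  paced t (pmap printed tr1 :: outs) (tr1 ++ EvEnd :: tr2).
Proof.
move=> ok z1 le_D [ok2 o2 d2 _]; rewrite /paced /output (segments_cat _ ok) all_cat /=.
rewrite ok2 andbT pmap_cat /= cats0 -[map _ _]/(output tr2) o2 size_cat addn1 z1 d2.
rewrite (leq_trans z1) //; split=> //.
by rewrite ?andbT; apply: sub_all ok => -[].
Qed.

(** The run extends to the end of the program, so [outs] lists all solutions still to come. Such
    facts are chained backwards from the end. *)
Definition runs c s k outs :=
  bounded V s -> exists tr s', exec c s tr s' /\ paced k outs tr.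

Lemma runs_weaken c s k k' outs : runs c s k outs -> k <= k' -> runs c s k' outs.
Proof.
move=> H le_k /H[tr [s' [ex [h1 h2 h3 h4]]]]; exists tr, s'; split=> //.
by split=> //; apply: leq_trans le_k.
Qed.

Lemma runs_seq c1 c2 s t k outs (Q : state -> Prop) :
  wp V S K c1 s t [::] Q -> t + k <= D ->
  (forall s', Q s' -> runs c2 s' k outs) -> runs (Seq c1 c2) s (t + k) outs.
Proof.
move=> H le_D HQ /H[tr [s1 [ex ok [po st] bs1 /HQ/(_ bs1)[tr' [s' [ex' pc]]]]]].
exists (tr ++ tr'), s'; split; first exact: ExecSeq ex ex'.
exact: paced_silent pc.
Qed.

(** [EvEnd] counts in its own segment, whence [t1.+1]; the [t2] operations after it are charged to
    the next segment. *)
Lemma runs_seq_end c1 c2 s t1 o t2 k outs (Q : state -> Prop) :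
  wp_end c1 s t1 o t2 Q -> t1 < D -> t2 + k <= D ->
  (forall s', Q s' -> runs c2 s' k outs) -> runs (Seq c1 c2) s t1.+1 (o :: outs).
Proof.
move=> H le1 le2 HQ /H[tr1 [tr2 [s1 [ex [ok1 ok2] [p1 p2 z1 z2] bs1]]]].
move=> /HQ/(_ bs1)[tr' [s' [ex' pc]]].
exists (tr1 ++ EvEnd :: (tr2 ++ tr')), s'; split.
  by rewrite -cat_cons catA; apply: ExecSeq ex ex'.
rewrite -p1; apply: (paced_end (k := t2 + k)) => //.
exact: paced_silent pc.
Qed.

Lemma runs_while a c s k outs : admissible K a -> reads_below S s a ->
  eval s a != 0 -> esize a + k <= D ->
  runs (Seq c (While a c)) s k outs -> runs (While a c) s (esize a + k) outs.
Proof.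
move=> ad ra a0 le_D H bs; have [tr [s' [ex pc]]] := H bs.
have [oka poa] := eval_trace_ok bs ad ra.
exists (eval_trace s a ++ tr), s'; split; last first.
  by apply: paced_silent pc => //; rewrite size_eval_trace.
inversion ex as [| | |c1 c2 s1 tr1 s2 tr2 s3 ex1 ex2| | | | | |]; subst.
exact: ExecWhileTrue ex1 ex2.
Qed.

Lemma runs_while_stop a c s : admissible K a -> reads_below S s a ->
  eval s a = 0 -> esize a <= D -> runs (While a c) s (esize a) [::].
Proof.
move=> ad ra a0 le_D bs; have [oka poa] := eval_trace_ok bs ad ra.
exists (eval_trace s a), s; split; first exact: ExecWhileFalse.
rewrite -[eval_trace s a]cats0 -[esize a]addn0.
by apply: paced_silent => //; rewrite ?size_eval_trace ?addn0.
Qed.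

End OneSolution.

(** * The traversal *)

(* Register 30 holds the size of the current set, 31 whether to go on, and 32
   the next candidate to be added to the current set. *)
Definition mark := Bin Add (Reg 14) (Reg 32).

Definition print_set := Seq (Assign 5 (Const 0))
  (for_loop 5 0 (If (tab 4 (Reg 5)) (Print (Reg 5)) Skip)).

Definition output_set := Seq print_set EndSol.

Definition accept := And (Not (tab 9 (Const 0))) (Eq (tab 11 (Const 0)) (Reg 32)).

Definition odd_depth := Bin Defs.Mod (Reg 30) (Const 2).

Definition enter :=
  Seq (incr 30) (Seq (Assign 32 (Const 0)) (If odd_depth Skip output_set)).

Definition reject := Seq (Write mark (Const 0)) (incr 32).

Definition try_vertex :=
  Seq (Seq (Write mark (Const 1)) check) (If accept enter reject).

(** The removed vertex is the one at which the sweep of the parent was interrupted. Rejecting it as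
    if it were a candidate restores the parent and resumes that sweep just behind it. *)
Definition to_parent :=
  Seq (Assign 30 (Bin Defs.Sub (Reg 30) (Const 1)))
    (Seq (Assign 32 (tab 11 (Const 0))) reject).

Definition leave := Seq check (Seq (If odd_depth output_set Skip) to_parent).

Definition search_step :=
  If (Bin Ltb (Reg 32) (Reg 0))
    (If (And (tab 2 (Reg 32)) (Not (tab 4 (Reg 32)))) try_vertex (incr 32))
    (If (Reg 30) leave (Assign 31 (Const 0))).

Definition search := While (Reg 31) search_step.

(** * Effect and cost of one step of the search *)

Section Search.
Variables (n : nat) (e : rel 'I_n) (es : seq ('I_n * 'I_n)).
Hypotheses (e_sym : symmetric e) (e_irr : irreflexive e) (ees : edge_list e es).
Hypothesis n0 : 0 < n.

Notation m := (size es).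
Notation inp := (nth 0 (encode es)).
Notation RN := (RN e).
Notation base := (table_base n m).
Notation vmax := (word_limit n m).
Notation smax := (space_limit n m).
Notation WP := (wp vmax smax expr_limit).
Notation WPE := (wp_end vmax smax expr_limit).
Notation frame := (frame n m).
Notation vec := (@vec n es).
Notation static := (static e es).
Notation rv := (rv es).

Definition at_node (A : {set 'I_n}) d x s :=
  [/\ static s, vec s 4 (fun v => v \in A), regs s 30 = d, regs s 32 = x
    & regs s 31 = 1].

Definition checked (A : {set 'I_n}) d x s :=
  [/\ at_node A d x s, memory s (base 9) = ~~ [forall a in A, okp e A a]
    & memory s (base 11) = removed e A].

Lemma at_node_frame A d x k s s' : frame k s s' -> 4 < k ->
  at_node A d x s -> at_node A d x s'.
Proof.
move=> fr k4 [st v4 r30 r32 r31]; have [fr_regs _] := fr.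
split; rewrite ?fr_regs //; first by apply: static_frame fr st; lia.
by apply: vec_frame fr _ v4; lia.
Qed.

(** Four stages over all vertices and three filling a single cell. *)
Definition check_time := 4 * (n * (n * 130 + 200) + 10) + 3 * (n * 130 + 210).

Lemma wp_check A d x s : at_node A d x s -> WP check s check_time [::] (checked A d x).
Proof.
move=> R0; have [st0 a0 _ _ _] := R0.
apply: (@wp_weaken _ _ _ _ _ _ _ _ (checked A d x)); last by [].
  apply: wp_seq0; apply: (wp_weaken (wp_ndom st0 a0) (leqnn _)) => s1 [f1 v5].
  have R1 := at_node_frame f1 isT R0; have [st1 a1 _ _ _] := R1.
  apply: wp_seq0; apply: (wp_weaken (wp_bad st1 v5) (leqnn _)) => s2 [f2 v6].
  have R2 := at_node_frame f2 isT R1; have [st2 a2 _ _ _] := R2.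
  have {}v5 := vec_frame f2 (isT : 5 != 6) v5.
  apply: wp_seq0; apply: (wp_weaken (wp_okp st2 v5 v6) (leqnn _)) => s3 [f3 v7].
  have R3 := at_node_frame f3 isT R2; have [st3 a3 _ _ _] := R3.
  have {}v5 := vec_frame f3 (isT : 5 != 7) v5.
  apply: wp_seq0; apply: (wp_weaken (wp_okw st3 v5) (leqnn _)) => s4 [f4 v8].
  have R4 := at_node_frame f4 isT R3; have [st4 a4 _ _ _] := R4.
  have {}v7 := vec_frame f4 (isT : 7 != 8) v7.
  apply: wp_seq0; apply: (wp_weaken (wp_fail n0 st4 a4 v7) (leqnn _)) => s5 [f5 c9].
  have R5 := at_node_frame f5 isT R4; have [st5 a5 _ _ _] := R5.
  have {}v8 := vec_frame f5 (isT : 8 != 9) v8.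
  apply: wp_seq0; apply: (wp_weaken (wp_weak n0 st5 a5 v8) (leqnn _)) => s6 [f6 c10].
  have R6 := at_node_frame f6 isT R5; have [st6 a6 _ _ _] := R6.
  have {}v8 := vec_frame f6 (isT : 8 != 10) v8.
  apply: (wp_weaken (wp_removed n0 st6 a6 v8 c10) (leqnn _)) => s7 [f7 c11].
  split=> //; first exact: at_node_frame f7 isT R6.
  have n2 : 0 < n * n by rewrite muln_gt0 n0.
  rewrite -(addn0 (base 9)) (frame_cell f7) // (frame_cell f6) // addn0.
  exact: c9.
by rewrite /check_time; lia.
Qed.

Definition labels (A : {set 'I_n}) : seq nat := [seq val x | x <- enum A].

Lemma flatten_labels (A : {set 'I_n}) (o : nat -> seq nat) :
  (forall a : 'I_n, o a = if a \in A then [:: val a] else [::]) ->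
  flatten [seq o j | j <- iota 0 n] = labels A.
Proof.
move=> oE; have EA : enum A = [seq a <- enum 'I_n | a \in A] by rewrite enumT.
rewrite -val_enum_ord -map_comp /labels EA.
by elim: (enum 'I_n) => //= a s ->; rewrite oE; case: (a \in A).
Qed.

Lemma wp_print_set A d x s : at_node A d x s ->
  WP print_set s (n * 20 + 10) (labels A) (frame 12 s).
Proof.
move=> R0; have [st a4 _ _ _] := R0.
pose o j := if insub j is Some a then if a \in A then [:: j] else [::] else [::].
have oE (a : 'I_n) : o a = if a \in A then [:: val a] else [::].
  by rewrite /o valK.
rewrite -(flatten_labels oE).
pose Inv j s' := frame 12 s s' /\ regs s' 5 = j.
apply: (@wp_weaken _ _ _ _ _ (1 + (n * (10 + 6) + 3)) _ _ (Inv n)); last first.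
- by move=> s' [].
- by lia.
apply: wp_seq0; apply: wp_assign => //.
apply: (wp_for (Inv := Inv)) => //.
- by rewrite /word_limit; lia.
- move=> j s' [fr rj]; split=> //.
  by have [[E _ _ _ _] _ _ _ _] := at_node_frame fr isT R0; apply: (env_n E).
- move=> j s' lt_j [fr rj]; pose a := Ordinal lt_j.
  have [[E _ _ _ _] a4' _ _ _] := at_node_frame fr isT R0.
  have [rd ev] : rv s' (tab 4 (Reg 5)) (a \in A) by apply: (rv_vec E a4' isT).
  rewrite -[j]/(val a) oE.
  have Q5 s'' : s' = s'' -> regs s'' 5 = j /\ Inv j.+1 (set_reg s'' 5 j.+1).
    move=> <-; split=> //; split=> //; split=> y; last first.
      exact: (proj2 fr).
      by move=> sy; rewrite /= updE; case: eqP sy => [->|_ sy] //; apply: (proj1 fr).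
  apply: (@wp_weaken _ _ _ _ _ (esize (tab 4 (Reg 5)) + 3) _ _ (eq s')) => //.
  apply: wp_if => //; rewrite ev; case: (a \in A) => /=; last exact: wp_Skip.
  have -> : [:: j] = [:: eval s' (Reg 5)] by rewrite /= rj.
  apply: (@wp_weaken _ _ _ _ _ 2 _ _ (eq s')) => //.
  by apply: wp_print.
by split=> //; split=> // y sy; rewrite /= updE; case: eqP sy => [->|].
Qed.

Lemma wp_output_set A d x s : at_node A d x s ->
  WPE output_set s (n * 20 + 10) (labels A) 0 (frame 12 s).
Proof.
move=> R0; apply: (@wp_end_weaken _ _ _ _ _ (n * 20 + 10 + 0) _ 0) => //; last 2 first.
- by rewrite addn0.
- move=> s'; exact.
rewrite -[labels A]cats0; apply: wp_end_seql.
apply: (wp_weaken (wp_print_set R0) (leqnn _)) => s' fr.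
exact: wp_EndSol.
Qed.


Lemma wp_end_seq0 c1 c2 s t t1 o t2 (Q : state -> Prop) :
  WP c1 s t [::] (fun s1 => WPE c2 s1 t1 o t2 Q) ->
  WPE (Seq c1 c2) s (t + t1) o t2 Q.
Proof. exact: wp_end_seql. Qed.

Lemma wp_mark A d (x : 'I_n) (b : bool) s : at_node A d x s ->
  WP (Write mark (Const b)) s 5 [::]
    (at_node (if b then x |: A else A :\ x) d x).
Proof.
move=> [st a4 r30 r32 r31]; have [E _ _ _ _] := st.
have mE : eval s mark = base 4 + x by rewrite /= r32 (env_base E (k := 4)).
have lt_x := ord_lt_sq x.
have fr : frame 4 s (set_mem s (eval s mark) b).
  split=> // a; rewrite mE /= updE; case: eqP => // ->.
  by rewrite /table_base mulSn; lia.
apply: wp_write => //; first by case: b {fr}.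
- by rewrite mE; apply: base_cell_lt.
- by case: b {fr} => //=; rewrite /word_limit; lia.
split=> //; first exact: static_frame fr st.
rewrite mE => v; rewrite /= updE eqn_add2l (inj_eq val_inj).
by case: b {fr}; rewrite !inE; case: eqVneq => //= _; apply: a4.
Qed.

Lemma at_node_set_reg A d x s r v : ~~ (r < 22) -> r != 31 -> at_node A d x s ->
  at_node A (if r == 30 then v else d) (if r == 32 then v else x) (set_reg s r v).
Proof.
move=> r22 r31 [[[E0 E1 E2 E3 E4 E5] m0 m1 v2 m3] a4 h30 h32 h31].
have le y : y < 22 -> (y == r) = false by lia.
split=> //=; rewrite ?updE.
- split=> //; split=> //=; rewrite ?updE ?le //.
  by move=> k k12; rewrite updE le ?E4 //; lia.
- by rewrite eq_sym; case: eqP.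
- by rewrite eq_sym; case: eqP.
by rewrite eq_sym (negPf r31).
Qed.

Lemma wp_reject A d (x : 'I_n) s : at_node A d x s ->
  WP reject s 8 [::] (at_node (A :\ x) d x.+1).
Proof.
move=> R0; apply: (@wp_weaken _ _ _ _ _ (5 + 3) _ _ (at_node (A :\ x) d x.+1)) => //.
apply: wp_seq0; apply: (wp_weaken (wp_mark false R0) (leqnn _)) => s1 R1.
have [_ _ _ r32 _] := R1; have lt_x := ltn_ord x.
apply: wp_assign => //; rewrite /= r32 addn1.
  by rewrite /word_limit; lia.
exact: (at_node_set_reg (r := 32) x.+1 isT isT R1).
Qed.

Lemma wp_try A d (x : 'I_n) s : at_node A d x s ->
  WP (Seq (Write mark (Const 1)) check) s (5 + check_time) [::]
    (checked (x |: A) d x).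
Proof.
move=> R0; apply: wp_seq0.
apply: (wp_weaken (wp_mark true R0) (leqnn _)) => s1 R1; exact: wp_check.
Qed.

Lemma rv_cell k A d x s v : at_node A d x s -> memory s (base k) = v -> k < 12 ->
  rv s (tab k (Const 0)) v.
Proof.
move=> [[E _ _ _ _] _ _ _ _] hk k12.
split; last by rewrite (eval_tab _ E) // addn0.
by apply: (reads_tab E) => //=; rewrite muln_gt0 n0.
Qed.

Lemma rv_accept A d (x : 'I_n) s : checked A d x s ->
  rv s accept ([forall a in A, okp e A a] && (removed e A == x)).
Proof.
move=> [R0 h9 h11]; have [_ _ _ r32 _] := R0.
apply: rv_and; last by apply: rv_eq; [apply: (rv_cell R0 h11) | apply: rv_reg].
by rewrite -[[forall a in A, _]]negbK; apply/rv_not/(rv_cell R0 h9).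
Qed.

Definition visit_time := check_time + n * 20 + 200.

Section Step.
Variables (A : {set 'I_n}) (s : state).
Hypothesis gA : good e A.

Section Vertex.
Variable x : 'I_n.
Hypothesis R0 : at_node A #|A| x s.

(** [A] is good, hence inside [RN], so only [x] has to be tested for redundancy; the cheap tests on
    [x] precede the costly check. *)
Lemma child_try : child (good e) (removed e) A x =
  ((x \in RN) && (x \notin A)) &&
    ([forall a in x |: A, okp e (x |: A) a] && (removed e (x |: A) == x)).
Proof.
rewrite /child {1}/good subUset sub1set (proj1 (andP gA)) andbT.
by case: (x \in A); rewrite ?andbF //= -!andbA; case: (x \in RN).
Qed.

Lemma rv_candidate : rv s (And (tab 2 (Reg 32)) (Not (tab 4 (Reg 32))))
  ((x \in RN) && (x \notin A)).
Proof.
have [[E _ _ v2 _] a4 _ r32 _] := R0.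
apply: rv_and; first by apply: (rv_vec E v2 isT).
by apply: rv_not; apply: (rv_vec E a4 isT).
Qed.

Lemma eval_lt_n : eval s (Bin Ltb (Reg 32) (Reg 0)) != 0.
Proof.
have [[E _ _ _ _] _ _ r32 _] := R0.
by rewrite /= r32 (env_n E) ltn_ord.
Qed.

(** Only redundant candidates can trigger a check. The factor [m] in the delay, rather than [n],
    rests on this. *)
Lemma step_next : ~~ child (good e) (removed e) A x ->
  WP search_step s (if x \in RN then visit_time else 30) [::]
    (at_node A #|A| x.+1).
Proof.
have [_ _ _ r32 _] := R0; have lt_x := ltn_ord x.
rewrite child_try => nch; have [rc ec] := rv_candidate.
have [cand|ncand] := boolP ((x \in RN) && (x \notin A)); last first.
  apply: (@wp_weaken _ _ _ _ _ (3 + (esize (And (tab 2 (Reg 32)) (Not (tab 4 (Reg 32)))) + 3))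
    _ _ (at_node A #|A| x.+1)) => //; last first.
    by case: ifP => // _; rewrite /visit_time /=; lia.
  apply: wp_if => //; rewrite eval_lt_n.
  apply: wp_if => //; rewrite ec (negPf ncand).
  apply: wp_assign => //; rewrite /= r32 addn1; first by rewrite /word_limit; lia.
  exact: (at_node_set_reg (r := 32) x.+1 isT isT R0).
rewrite cand /= in nch; have /andP[xR xA] := cand; rewrite xR.
apply: (@wp_weaken _ _ _ _ _ (3 + (esize (And (tab 2 (Reg 32)) (Not (tab 4 (Reg 32)))) +
  (5 + check_time + (esize accept + 8)))) _ _ (at_node A #|A| x.+1)) => //; last first.
  by rewrite /visit_time /=; lia.
apply: wp_if => //; rewrite eval_lt_n.
apply: wp_if => //; rewrite ec cand.
apply: wp_seq0; apply: (wp_weaken (wp_try R0) (leqnn _)) => s1 C1.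
have [ra ea] := rv_accept C1; have [R1 _ _] := C1.
apply: wp_if => //; rewrite ea (negPf nch).
by apply: (wp_weaken (wp_reject R1) (leqnn _)) => s2; rewrite setU1K.
Qed.

Hypothesis chx : child (good e) (removed e) A x.

Let A' := x |: A.

Lemma wp_enter_prefix s1 : checked A' #|A| x s1 ->
  WP (incr 30) s1 3 [::] (fun s2 => WP (Assign 32 (Const 0)) s2 1 [::] (at_node A' #|A'| 0)).
Proof.
have /and3P[xA _ _] := chx.
move=> [R1 _ _]; have [_ _ r30 _ _] := R1.
have le_A : #|A| <= n by rewrite -[n in _ <= n]card_ord max_card.
apply: wp_assign => //; rewrite /= r30 addn1; first by rewrite /word_limit; lia.
have R2 := at_node_set_reg (r := 30) #|A|.+1 isT isT R1.
apply: wp_assign => //=.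
have := at_node_set_reg (r := 32) 0 isT isT R2.
by rewrite /= cardsU1 xA.
Qed.

Lemma rv_odd_depth B x' s1 : at_node B #|B| x' s1 -> rv s1 odd_depth (odd #|B|).
Proof. by move=> [_ _ r30 _ _]; split=> //=; rewrite r30 modn2. Qed.

Lemma step_enter_silent : odd #|A'| ->
  WP search_step s visit_time [::] (at_node A' #|A'| 0).
Proof.
move=> oddA; have [rc ec] := rv_candidate.
have := chx; rewrite child_try => /andP[cand acc].
apply: (@wp_weaken _ _ _ _ _ (3 + (esize (And (tab 2 (Reg 32)) (Not (tab 4 (Reg 32)))) +
  (5 + check_time + (esize accept + (3 + (1 + (esize odd_depth + 0)))))))
  _ _ (at_node A' #|A'| 0)) => //; last first.
  by rewrite /visit_time /=; lia.
apply: wp_if => //; rewrite eval_lt_n.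
apply: wp_if => //; rewrite ec cand.
apply: wp_seq0; apply: (wp_weaken (wp_try R0) (leqnn _)) => s1 C1.
have [ra ea] := rv_accept C1.
apply: wp_if => //; rewrite ea acc.
apply: wp_seq0; apply: (wp_weaken (wp_enter_prefix C1) (leqnn _)) => s2 W2.
apply: wp_seq0; apply: (wp_weaken W2 (leqnn _)) => s3 R3.
have [ro eo] := rv_odd_depth R3.
by apply: wp_if => //; rewrite eo oddA; apply: wp_Skip.
Qed.

Lemma step_enter_output : ~~ odd #|A'| ->
  WPE search_step s visit_time (labels A') 0 (at_node A' #|A'| 0).
Proof.
move=> oddA; have [rc ec] := rv_candidate.
have := chx; rewrite child_try => /andP[cand acc].
apply: (@wp_end_weaken _ _ _ _ _ (3 + (esize (And (tab 2 (Reg 32)) (Not (tab 4 (Reg 32)))) +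
  (5 + check_time + (esize accept + (3 + (1 + (esize odd_depth + (n * 20 + 10))))))))
  _ 0 _ _ (at_node A' #|A'| 0)) => //; last first.
  by rewrite /visit_time /=; lia.
apply: wp_end_if => //; rewrite eval_lt_n.
apply: wp_end_if => //; rewrite ec cand.
apply: wp_end_seq0; apply: (wp_weaken (wp_try R0) (leqnn _)) => s1 C1.
have [ra ea] := rv_accept C1.
apply: wp_end_if => //; rewrite ea acc.
apply: wp_end_seq0; apply: (wp_weaken (wp_enter_prefix C1) (leqnn _)) => s2 W2.
apply: wp_end_seq0; apply: (wp_weaken W2 (leqnn _)) => s3 R3.
have [ro eo] := rv_odd_depth R3.
apply: wp_end_if => //; rewrite eo (negPf oddA).
apply: (wp_end_weaken (wp_output_set R3)) => // s4 f4.
exact: at_node_frame f4 isT R3.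
Qed.

End Vertex.

Section Leave.
Variable r : 'I_n.
Hypotheses (rA : r \in A) (rE : removed e A = r).
Hypothesis R0 : at_node A #|A| n s.

Lemma wp_to_parent s1 : checked A #|A| n s1 ->
  WP to_parent s1 20 [::] (at_node (A :\ r) #|A :\ r| r.+1).
Proof.
move=> [R1 _ h11]; have [_ _ r30 _ _] := R1.
have cA : #|A| = #|A :\ r|.+1 by rewrite (cardsD1 r) rA.
have le_A : #|A| <= n by rewrite -[n in _ <= n]card_ord max_card.
apply: (@wp_weaken _ _ _ _ _ (3 + (esize (tab 11 (Const 0)) + 8))
  _ _ (at_node (A :\ r) #|A :\ r| r.+1)) => //.
apply: wp_seq0; apply: wp_assign => //=; rewrite r30.
  by rewrite /word_limit; lia.
have R2 := at_node_set_reg (r := 30) (#|A| - 1) isT isT R1.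
rewrite /= cA subn1 /= in R2 *; set s2 := set_reg _ _ _ in R2 *.
have [rv11 ev11] : rv s2 (tab 11 (Const 0)) r.
  by apply: (rv_cell R2) => //; rewrite /s2 /= h11 rE.
apply: wp_seq0; apply: wp_assign => //; rewrite ev11.
  by have := ltn_ord r; rewrite /word_limit; lia.
apply: wp_reject; exact: (at_node_set_reg (r := 32) (val r) isT isT R2).
Qed.

Lemma eval_done : eval s (Bin Ltb (Reg 32) (Reg 0)) = 0.
Proof.
have [[E _ _ _ _] _ _ r32 _] := R0.
by rewrite /= r32 (env_n E) ltnn.
Qed.

Lemma eval_depth : eval s (Reg 30) != 0.
Proof. by have [_ _ /= -> _ _] := R0; rewrite (cardsD1 r) rA. Qed.

Lemma checked_frame B d x s1 s2 : frame 12 s1 s2 -> checked B d x s1 -> checked B d x s2.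
Proof.
move=> fr [R1 h9 h11]; have n2 : 0 < n * n by rewrite muln_gt0 n0.
split; first exact: at_node_frame fr isT R1.
  by rewrite -(addn0 (base 9)) (frame_cell fr) // addn0.
by rewrite -(addn0 (base 11)) (frame_cell fr) // addn0.
Qed.

Lemma step_leave_silent : ~~ odd #|A| ->
  WP search_step s visit_time [::] (at_node (A :\ r) #|A :\ r| r.+1).
Proof.
move=> oddA; apply: (@wp_weaken _ _ _ _ _ (3 + (1 + (check_time +
  ((esize odd_depth + 0) + 20)))) _ _ (at_node (A :\ r) #|A :\ r| r.+1)) => //; last first.
  by rewrite /visit_time /=; lia.
apply: wp_if => //; rewrite eval_done.
apply: wp_if => //; rewrite eval_depth.
apply: wp_seq0; apply: (wp_weaken (wp_check R0) (leqnn _)) => s1 C1.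
have [R1 _ _] := C1; have [ro eo] := rv_odd_depth R1.
apply: wp_seq0; apply: wp_if => //; rewrite eo (negPf oddA).
by apply: wp_Skip; apply: wp_to_parent.
Qed.

(** The return to the parent comes after [EvEnd]: its 20 operations are charged to the next
    segment. *)
Lemma step_leave_output : odd #|A| ->
  WPE search_step s visit_time (labels A) 20 (at_node (A :\ r) #|A :\ r| r.+1).
Proof.
move=> oddA; apply: (@wp_end_weaken _ _ _ _ _ (3 + (1 + (check_time +
  ((esize odd_depth + (n * 20 + 10)))))) _ (0 + 20) _ _
  (at_node (A :\ r) #|A :\ r| r.+1)) => //; last first.
  by rewrite /visit_time /=; lia.
apply: wp_end_if => //; rewrite eval_done.
apply: wp_end_if => //; rewrite eval_depth.
apply: wp_end_seq0; apply: (wp_weaken (wp_check R0) (leqnn _)) => s1 C1.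
have [R1 _ _] := C1; have [ro eo] := rv_odd_depth R1.
apply: wp_end_seqr; apply: wp_end_if => //; rewrite eo oddA.
apply: (wp_end_weaken (wp_output_set R1)) => // s2 f2.
by apply: wp_to_parent; apply: checked_frame C1.
Qed.

End Leave.
End Step.

End Search.

Section Rules.
Variables (V S K D : nat).

Lemma runs_if a c1 c2 s k outs : admissible K a -> reads_below S s a ->
  esize a + k <= D -> runs V S K D (if eval s a != 0 then c1 else c2) s k outs ->
  runs V S K D (If a c1 c2) s (esize a + k) outs.
Proof.
move=> ad ra le_D H bs; have [tr [s' [ex pc]]] := H bs.
have [oka poa] := eval_trace_ok bs ad ra.
exists (eval_trace s a ++ tr), s'; split; last first.
  by apply: paced_silent pc => //; rewrite size_eval_trace.
by move: ex; case: ifPn => [a0|/negPn/eqP a0]; [apply: ExecIfTrue|apply: ExecIfFalse].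
Qed.

Lemma runs_end c s t1 o t2 (Q : state -> Prop) : wp_end V S K c s t1 o t2 Q ->
  t1 < D -> t2 <= D -> runs V S K D c s t1.+1 [:: o].
Proof.
move=> H lt1 le2 /H[tr1 [tr2 [s' [ex [ok1 ok2] [p1 p2 z1 z2] bs q]]]].
exists (tr1 ++ EvEnd :: tr2), s'; split=> //; rewrite -p1.
apply: (paced_end (k := t2 + 0)) => //; rewrite -[tr2]cats0.
by apply: paced_silent => //; rewrite addn0.
Qed.

End Rules.

(** * Counting edges and redundant vertices *)

Section EdgeList.
Variables (n : nat) (e : rel 'I_n) (es : seq ('I_n * 'I_n)).
Hypotheses (e_sym : symmetric e) (e_irr : irreflexive e) (ees : edge_list e es).

Lemma uniq_edge_list : uniq es.
Proof.
apply: count_mem_uniq => -[x y]; rewrite -has_pred1 has_count.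
have le1 : count_mem (x, y) es <= 1.
  by apply: leq_trans (leq_addr (count_mem (y, x) es) _) _; rewrite ees; case: (e x y).
by move: le1; case: (count_mem _ _) => [|[]].
Qed.

Lemma size_edge_list : size es <= n * n.
Proof.
rewrite -(card_uniqP uniq_edge_list) (leq_trans (max_card _)) //.
by rewrite card_prod card_ord.
Qed.

(** Orienting edges upwards is injective on the list, because no edge occurs in both
    orientations. *)
Lemma size_num_edges : size es <= num_edges e.
Proof.
pose f (p : 'I_n * 'I_n) := if p.1 < p.2 then p else (p.2, p.1).
have f_inj : {in es &, injective f}.
  move=> [a b] [c d] es1 es2; rewrite /f /=.
  have swap_notin x y : (x, y) \in es -> (y, x) \in es -> False.
    rewrite -!has_pred1 !has_count => c1 c2.
    by have := leq_add c1 c2; rewrite ees; case: (e x y).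
  case: ltnP => _; case: ltnP => _ [h1 h2]; subst => //.
    by case: (swap_notin _ _ es1 es2).
  by case: (swap_notin _ _ es1 es2).
have := uniq_edge_list; rewrite -(map_inj_in_uniq f_inj) => uf.
rewrite -(size_map f) -(card_uniqP uf) /num_edges.
apply/subset_leq_card/subsetP => q /mapP[[a b] /(edge_es ees) eab ->].
rewrite inE /f /=; case: (ltnP a b) => [lt_ab|le_ba] /=; first by rewrite lt_ab.
rewrite e_sym eab andbT ltn_neqAle le_ba andbT.
by apply: contraTneq eab => /val_inj ->; rewrite e_irr.
Qed.

(** A redundant [x] has some [y] other than [x] with [N y] inside [N x]; then [x] and [y] are
    adjacent, so [x] is an endpoint of a listed edge. *)
Lemma card_RN : #|RN e| <= (size es).*2.
Proof.
have -> : (size es).*2 = size ([seq p.1 | p <- es] ++ [seq p.2 | p <- es]).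
  by rewrite size_cat !size_map addnn.
apply: leq_trans (card_size _); apply/subset_leq_card/subsetP => x.
rewrite mem_RN => /existsP[y /andP[syx nyx]].
have exy : e x y.
  apply: clnbh_edge; last by apply: (subsetP syx); rewrite clnbh_refl.
  by apply: contraNneq nyx => ->; rewrite subxx leqnn.
have : 0 < count_mem (x, y) es + count_mem (y, x) es by rewrite ees exy.
rewrite addn_gt0 -!has_count !has_pred1 mem_cat => /orP[] h.
  by apply/orP; left; apply/mapP; exists (x, y).
by apply/orP; right; apply/mapP; exists (y, x).
Qed.

End EdgeList.

Lemma good_removed (n : nat) (e : rel 'I_n) (A : {set 'I_n}) : symmetric e ->
  irreflexive e -> path_free e 8 -> chordal e -> good e A -> A != set0 ->
  exists2 a, a \in A /\ removed e A = a & good e (A :\ a).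
Proof.
move=> e_sym e_irr pf ch gA A0; have [a [aA rE aL]] := removed_spec e A0.
by exists a; rewrite // good_remove.
Qed.

(** * The time until the next output *)

Section Traversal.
Variables (n : nat) (e : rel 'I_n) (es : seq ('I_n * 'I_n)).
Variable D : nat.

Notation m := (size es).
Notation node A x := (at_node e es A #|A| x).
Notation RUN := (runs (word_limit n m) (space_limit n m) expr_limit D search).

(** A visit, the guard of the main loop and an [EvEnd]. *)
Definition move_time := visit_time n + 2.

Definition vertex_time (y : 'I_n) := if y \in RN e then move_time else 32.

Definition sweep_time x := \sum_(y <- drop x (enum 'I_n)) vertex_time y.

(* At odd depth the current set is output on leaving it at the latest.  At even
   depth the next output may have to wait for one more sweep, at the next node. *)
Definition next_output_time (A : {set 'I_n}) x :=
  sweep_time x + move_time + (if odd #|A| then 0 else sweep_time 0 + move_time).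

Lemma drop_enum (x : 'I_n) : drop x (enum 'I_n) = x :: drop x.+1 (enum 'I_n).
Proof. by rewrite (drop_nth x) ?size_enum_ord // nth_ord_enum. Qed.

Lemma sweep_timeS (x : 'I_n) : sweep_time x = vertex_time x + sweep_time x.+1.
Proof. by rewrite /sweep_time drop_enum big_cons. Qed.

Lemma sweep_time_le x : sweep_time x <= sweep_time 0.
Proof.
rewrite [leqRHS]/sweep_time drop0 -[enum 'I_n in leqRHS](cat_take_drop x).
by rewrite big_cat leq_addl.
Qed.

Lemma next_output_time_le A x :
  next_output_time A x <= sweep_time 0 + move_time + (sweep_time 0 + move_time).
Proof.
rewrite /next_output_time leq_add ?leq_add2r ?sweep_time_le //.
by case: odd.
Qed.

Lemma loop_silent A d x s t k outs (Q : state -> Prop) : at_node e es A d x s ->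
  wp (word_limit n m) (space_limit n m) expr_limit search_step s t [::] Q ->
  (forall s', Q s' -> RUN s' k outs) -> 1 + (t + k) <= D ->
  RUN s (1 + (t + k)) outs.
Proof.
move=> [_ _ _ _ r31] H HQ le_D; apply: runs_while => //; first by rewrite /= r31.
by apply: (runs_seq H _ HQ); lia.
Qed.

Lemma loop_output A d x s t1 o t2 k outs (Q : state -> Prop) :
  at_node e es A d x s ->
  wp_end (word_limit n m) (space_limit n m) expr_limit search_step s t1 o t2 Q ->
  (forall s', Q s' -> RUN s' k outs) -> 1 + t1.+1 <= D -> t2 + k <= D ->
  RUN s (1 + t1.+1) (o :: outs).
Proof.
move=> [_ _ _ _ r31] H HQ le_D le_D2; apply: runs_while => //; first by rewrite /= r31.
by apply: (runs_seq_end H _ le_D2 HQ); lia.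
Qed.

Hypothesis n0 : 0 < n.
Hypothesis D_large :
  sweep_time 0 + move_time + (sweep_time 0 + move_time) + move_time + 20 <= D.

(** Continuation form: [outs] is what follows once the sweep at [A] is over. The outer induction is
    on the levels left below [A], the inner one on the [d] candidates left. An odd child is output
    only when left, possibly after a full sweep of its own: this is the extra sweep granted to even
    nodes. *)
Lemma traversal f A : good e A -> n <= #|A| + f ->
  forall d x outs, d + x = n ->
  (forall s, node A n s -> RUN s (next_output_time A n) outs) ->
  forall s, node A x s -> RUN s (next_output_time A x)
    ([seq labels B | B <- flatten
       [seq branch (good e) (removed e) (below (good e) (removed e) f) A y
         | y <- drop x (enum 'I_n)]] ++ outs).
Proof.
elim/ltn_ind: f A => f IHf A gA le_n.
elim=> [|d IHd] x outs dx Hn s R.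
  by rewrite add0n in dx; subst x; rewrite drop_oversize ?size_enum_ord //; apply: Hn.
have lt_x : x < n by lia.
pose y := Ordinal lt_x; have dx' : d + x.+1 = n by lia.
rewrite (drop_enum y) /= map_cat -catA; set rest := _ ++ outs.
have Hrest s' : node A x.+1 s' -> RUN s' (next_output_time A x.+1) rest.
  exact: IHd.
have tE : next_output_time A x = vertex_time y + next_output_time A x.+1.
  by rewrite /next_output_time (sweep_timeS y) !addnA.
have mE : move_time = visit_time n + 2 by [].
have le_x := next_output_time_le A x; have le_xS := next_output_time_le A x.+1.
rewrite {1}/branch; case: ifP => [chy|/negbT nch]; last first.
  rewrite tE; apply: (runs_weaken (k := 1 + ((if y \in RN e then visit_time n else 30)
    + next_output_time A x.+1))).
    apply: (loop_silent R (step_next n0 gA (x := y) R nch) Hrest).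
    by move: le_x; rewrite tE /vertex_time; case: ifP => _; lia.
  by rewrite /vertex_time; case: ifP => _; lia.
have /and3P[yA gA' /eqP rA'] := chy.
set A' := y |: A in chy gA' rA' *.
have yR : y \in RN e by apply: good_RN gA' _; rewrite setU11.
have yA' : y \in A' by rewrite setU11.
have cA' : #|A'| = #|A|.+1 by rewrite cardsU1 yA.
have A'E : A' :\ y = A by rewrite setU1K.
have f0 : 0 < f.
  have : #|A'| <= n by rewrite -[n in _ <= n]card_ord max_card.
  by lia.
case: f IHf le_n {IHd Hrest} @rest Hrest f0 => // f IHf le_n rest Hrest _.
have le_n' : n <= #|A'| + f by rewrite cA'; lia.
have le_sweep := sweep_time_le x.+1.
have le_A' := next_output_time_le A' 0.
have Hbelow outs' : (forall s'', node A' n s'' -> RUN s'' (next_output_time A' n) outs') ->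
    forall s', node A' 0 s' -> RUN s' (next_output_time A' 0)
      ([seq labels B | B <- below (good e) (removed e) f.+1 A'] ++ outs').
  move=> H s'; have := IHf f (ltnSn f) A' gA' le_n' n 0 outs' (addn0 n) H s'.
  by rewrite drop0.
(* Below an odd node the child is output on entry, so the time budget starts afresh inside it. *)
have [odd_A|even_A] := boolP (odd #|A|).
  have even_A' : ~~ odd #|A'| by rewrite cA' /= odd_A.
  apply: (runs_weaken (k := 1 + (visit_time n).+1)); last first.
    by rewrite tE /vertex_time yR; lia.
  apply: (loop_output R (step_enter_output n0 gA (x := y) R chy even_A')
    (Hbelow rest _)) => [s1 R1||].
  - apply: (runs_weaken (k := 1 + (visit_time n + next_output_time A x.+1))).
      apply: (loop_silent R1 (step_leave_silent n0 gA' yA' rA' R1 even_A')) => [s2|].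
        by rewrite A'E; apply: Hrest.
      by move: le_xS; lia.
    rewrite /next_output_time odd_A (negPf even_A'); lia.
  - by lia.
  - by lia.
have odd_A' : odd #|A'| by rewrite cA' /= even_A.
rewrite map_rcons cat_rcons.
apply: (runs_weaken (k := 1 + (visit_time n + next_output_time A' 0))); last first.
  rewrite tE /vertex_time yR /next_output_time odd_A' (negPf even_A); lia.
apply: (loop_silent R (step_enter_silent n0 gA (x := y) R chy odd_A')
  (Hbelow (labels A' :: rest) _)) => [s1 R1|]; last by lia.
apply: (runs_weaken (k := 1 + (visit_time n).+1)); last first.
  by rewrite /next_output_time; lia.
apply: (loop_output (k := next_output_time A x.+1) R1
  (step_leave_output n0 gA' yA' rA' R1 odd_A')) => [s2||].
- by rewrite A'E; apply: Hrest.
- by lia.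
by lia.
Qed.

End Traversal.

(** * Initialisation and the complete run *)

Fixpoint set_bases k j :=
  if j is j'.+1 then
    Seq (Assign (11 + k) (Bin Add (Reg (10 + k)) (Reg 2))) (set_bases k.+1 j')
  else Skip.

Definition prep :=
  Seq (Assign 0 (Read (Const 0)))
  (Seq (Assign 2 (Bin Mul (Reg 0) (Reg 0)))
  (Seq (Assign 3 (Const 1))
  (Seq (Assign 31 (Const 1))
  (Seq (Assign 10 (Bin Add (Const 2) (Bin Add (Reg 1) (Reg 1))))
  (Seq (set_bases 0 11)
  (Seq adj_stage
  (Seq (subset_stage 1 (fun=> Const 1))
  (Seq redundant_stage (subset_stage 3 (fun a => Not (tab 2 a))))))))))).

(** Without edges the delay bound is a constant, too short to fill tables, but then [RN] is empty
    and the empty set is the only member. Otherwise the empty set, a node of even depth, is output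
    before the search. *)
Definition program :=
  Seq (Assign 1 (Read (Const 1)))
    (If (Reg 1) (Seq prep (Seq EndSol search)) EndSol).

Section Program.
Variables (n : nat) (e : rel 'I_n) (es : seq ('I_n * 'I_n)).
Hypotheses (e_sym : symmetric e) (e_irr : irreflexive e) (ees : edge_list e es).

Notation m := (size es).
Notation inp := (nth 0 (encode es)).
Notation base := (table_base n m).
Notation vmax := (word_limit n m).
Notation smax := (space_limit n m).
Notation WP := (wp vmax smax expr_limit).

Lemma base_le k : k < 12 -> base k <= vmax.
Proof. by rewrite /word_limit /table_base; nia. Qed.

Lemma wp_set_bases j k s : k + j = 11 -> regs s 2 = n * n ->
  regs s (10 + k) = base k ->
  WP (set_bases k j) s (3 * j) [::] (fun s' =>
    [/\ forall a, memory s' a = memory s a,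
        forall x, x <= 10 + k \/ 21 < x -> regs s' x = regs s x
      & forall i, i <= j -> regs s' (10 + (k + i)) = base (k + i)]).
Proof.
elim: j k s => [|j IH] k s kj r2 rk.
  apply: wp_Skip; split=> // i; rewrite leqn0 => /eqP->.
  by rewrite addn0.
rewrite /= mulnS; apply: wp_seq0; apply: wp_assign => //.
  have -> : eval s (Bin Add (Reg (10 + k)) (Reg 2)) = base k.+1.
    by rewrite [LHS]/= rk r2 /table_base; lia.
  by apply: base_le; lia.
have -> : eval s (Bin Add (Reg (10 + k)) (Reg 2)) = base k.+1.
  by rewrite [LHS]/= rk r2 /table_base; lia.
set s1 := set_reg _ _ _.
have regs1 x : x <= 10 + k \/ 21 < x -> regs s1 x = regs s x.
  by move=> h; rewrite /s1 /= updE; case: eqP => //; lia.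
apply: (wp_weaken (IH k.+1 s1 _ _ _) (leqnn _)).
- by lia.
- by rewrite regs1 // ; lia.
- by rewrite /s1 /= updE addnS eqxx.
move=> s2 [mem2 regs2 base2]; split=> [a|x h|[|i] le_i].
- by rewrite mem2.
- by rewrite regs2 ?regs1 //; lia.
- by rewrite !addn0 regs2 ?regs1 //; lia.
by rewrite -addSnnS base2.
Qed.

Lemma size_encode : size (encode es) = base 0.
Proof.
rewrite /encode /table_base /= mul0n addn0; congr _.+2.
by elim: (es) => //= p s ->.
Qed.

Lemma encode_le a : inp a <= vmax.
Proof.
have [lt_a|ge_a] := ltnP a (size (encode es)); last by rewrite nth_default.
apply: (allP (_ : all (fun v => v <= vmax) (encode es))) (mem_nth 0 lt_a).
rewrite /= /word_limit /table_base; apply/and3P; split; [lia | lia|].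
apply/allP => v /flatten_mapP[p _]; rewrite !inE => /orP[] /eqP->.
  by apply: leq_trans (ltnW (ltn_ord p.1)) _; lia.
by apply: leq_trans (ltnW (ltn_ord p.2)) _; lia.
Qed.

Definition loaded := set_reg (init (encode es)) 1 m.

Definition prep_time :=
  3 * (n * n * (m * 130 + 200) + 10) + (n * (n * 130 + 200) + 10) + 100.

Lemma wp_prep : 0 < n -> WP prep loaded prep_time [::] (at_node e es set0 0 0).
Proof.
move=> n0; have n2 : 0 < n * n by rewrite muln_gt0 n0.
apply: (@wp_weaken _ _ _ _ _ (2 + (3 + (1 + (1 + (5 + (3 * 11 +
  ((n * n * (m * 130 + 200) + 10) + ((n * n * (m * 130 + 200) + 10) +
  ((n * (n * 130 + 200) + 10) + (n * n * (m * 130 + 200) + 10))))))))))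
  _ _ (at_node e es set0 0 0)) => //; last by rewrite /prep_time; lia.
apply: wp_seq0; apply: wp_assign => //; first by rewrite /word_limit /=; lia.
apply: wp_seq0; apply: wp_assign => //.
  by rewrite /= /upd /= /word_limit /table_base; lia.
apply: wp_seq0; apply: wp_assign => //.
apply: wp_seq0; apply: wp_assign => //.
apply: wp_seq0; apply: wp_assign => //.
  by rewrite /= /word_limit /table_base /upd /=; lia.
set s0 := set_reg _ 10 _.
apply: wp_seq0; apply: (wp_weaken (@wp_set_bases 11 0 s0 _ _ _) (leqnn _)) => //.
  by rewrite /s0 /= /table_base /upd /=; lia.
move=> s1 [mem1 regs1 base1].
have E1 : env n m inp s1.
  split; rewrite ?regs1 //; try by left.
have mem0 k c : k < 12 -> memory s1 (base k + c) = 0.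
  by move=> k12; rewrite mem1; apply: nth_default; rewrite size_encode /table_base; lia.
(* Untouched cells hold 0, so table 4 already represents the empty set. *)
have A1 : vec es s1 4 (fun v => v \in set0).
  by move=> v; rewrite mem0 // inE.
have regs30 x : 29 < x -> regs s1 x = (x == 31).
  move=> h; rewrite regs1 /s0 /=; last by right; lia.
  by rewrite !updE; do !(case: eqP => [?|_]; first lia).
apply: wp_seq0; apply: (wp_weaken (wp_adj e_sym ees E1) (leqnn _)) => s2 [f2 m0].
have E2 := frame_env f2 E1.
have A2 := vec_frame f2 (isT : 4 != 0) A1.
apply: wp_seq0; apply: (wp_weaken (wp_subset e_sym ees (F := fun=> Const 1) (P := predT) E2
  (isT : 1 < 12) (isT : 0 != 1) m0 _ _ _) (leqnn _)) => //.
  by move=> a /=; lia.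
move=> s3 [f3 m1].
have E3 := frame_env f3 E2.
have A3 := vec_frame f3 (isT : 4 != 1) A2.
have {}m0 := mat_frame f3 (isT : 0 != 1) m0.
have {}m1 : mat es s3 1 (fun u v => ~~ (clnbh e u \subset clnbh e v)).
  move=> u v; rewrite m1 (_ : [set _ in _ | _] = clnbh e u) //.
  by apply/setP => y; rewrite in_set andbT.
apply: wp_seq0; apply: (wp_weaken (wp_redundant E3 m1) (leqnn _)) => s4 [f4 v2].
have E4 := frame_env f4 E3.
have A4 := vec_frame f4 (isT : 4 != 2) A3.
have {}m0 := mat_frame f4 (isT : 0 != 2) m0.
have {}m1 := mat_frame f4 (isT : 1 != 2) m1.
apply: (wp_weaken (wp_subset e_sym ees (F := fun a => Not (tab 2 a))
  (P := fun y => y \notin RN e) E4 (isT : 3 < 12) (isT : 0 != 3) m0 _ _ _) (leqnn _)).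
- by move=> a /=; lia.
- by [].
- move=> s' a v fr E' ra; have v2' := vec_frame fr (isT : 2 != 3) v2.
  by apply: rv_not; apply: (rv_vec E' v2' isT).
move=> s5 [f5 m3].
have regs5 x : 29 < x -> regs s5 x = (x == 31).
  move=> h; have ns : ~~ scratch x by rewrite /scratch; lia.
  by rewrite (proj1 f5) // (proj1 f4) // (proj1 f3) // (proj1 f2) // regs30.
split; rewrite ?regs5 //; last exact: vec_frame f5 (isT : 4 != 3) A4.
split.
- exact: frame_env f5 E4.
- exact: mat_frame f5 (isT : 0 != 3) m0.
- exact: mat_frame f5 (isT : 1 != 3) m1.
- exact: vec_frame f5 (isT : 2 != 3) v2.
move=> u v; rewrite m3 (_ : [set _ in _ | _] = clnbh e u :\: RN e) //.
by apply/setP => y; rewrite in_set in_setD andbC.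
Qed.

Hypotheses (pf : path_free e 8) (ch : chordal e).

(** The level beyond [n] matches [traversal] at the root, where the sweep unfolds one level above
    fuel [n]. *)
Definition solutions := set0 :: below (good e) (removed e) n.+1 set0.

Lemma good_set0 : good e set0.
Proof. by rewrite /good sub0set; apply/forall_inP => a; rewrite inE. Qed.

Lemma solutionsP : perm_eq solutions (enum (D_RN e)).
Proof.
apply: perm_below => //; first by move=> A; apply: good_removed.
- exact: good_set0.
by move=> A; rewrite (D_RN_good e_sym e_irr pf ch).
Qed.

(** In units of [n ^ 2 * m] this leaves room for two sweeps of [6 * 1000], three moves of 2700, and
    the initialisation; the [+ 1] serves graphs without edges. *)
Definition delay_bound := 40 * 1000 * (n ^ 2 * m + 1).

Lemma move_time_le : 0 < n -> move_time n <= 2700 * n ^ 2.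
Proof. by rewrite /move_time /visit_time /check_time expnS expn1; nia. Qed.

(** At most [2m] candidates cost a move of [2700 * n ^ 2]; the hypothesis [0 < m] absorbs the
    [32 * n] spent on all candidates. *)
Lemma sweep_time_bound : 0 < n -> 0 < m -> sweep_time e 0 <= 6 * 1000 * (n ^ 2 * m).
Proof.
move=> n0 m0; rewrite /sweep_time drop0 big_enum /=.
apply: leq_trans (_ : \sum_(y < n) ((y \in RN e) * move_time n + 32) <= _).
  apply: leq_sum => y _; rewrite /vertex_time.
  by case: (y \in RN e); rewrite ?mul1n ?leq_addr.
rewrite big_split sum_nat_const card_ord -big_distrl /=.
have -> : \sum_(y < n) (y \in RN e) = #|RN e|.
  by rewrite -sum1_card [RHS]big_mkcond; apply: eq_bigr => y _; case: (y \in RN e).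
have := card_RN ees; have := move_time_le n0; rewrite expnS expn1.
set T := move_time n; set R := #|RN e|; rewrite -muln2 => leT leR.
have := leq_mul leR leT.
move: (R * T) => RT h; apply: leq_trans (leq_add h (leqnn _)) _.
have : n * 32 <= 32 * (n * n * m) by nia.
by move=> h2; apply: leq_trans (leq_add (leqnn _) h2) _; lia.
Qed.

Lemma step_stop s : 0 < n -> at_node e es set0 #|(set0 : {set 'I_n})| n s ->
  WP search_step s 5 [::] (fun s' => regs s' 31 = 0).
Proof.
move=> n0 R; have [_ _ r30 _ _] := R.
apply: (@wp_weaken _ _ _ _ _ (3 + (1 + 1)) _ _ (fun s' => regs s' 31 = 0)) => //.
apply: wp_if => //; rewrite (eval_done R).
apply: wp_if => //; rewrite [eval _ _]r30 cards0.
exact: wp_assign.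
Qed.

Lemma runs_program : runs vmax smax expr_limit delay_bound program (init (encode es))
  delay_bound [seq labels A | A <- solutions].
Proof.
have D40 : 10 <= delay_bound by rewrite /delay_bound; lia.
have HQ s' : loaded = s' -> runs vmax smax expr_limit delay_bound
    (If (Reg 1) (Seq prep (Seq EndSol search)) EndSol) s' (delay_bound - 2)
    [seq labels A | A <- solutions].
  move=> <-; have labels0 : labels (set0 : {set 'I_n}) = [::].
    by rewrite /labels enum_set0.
  have [m0|m_gt0] := posnP m.
    (* Any other solution would be a nonempty subset of [RN], which has at most [2m = 0]
       elements. *)
    have -> : solutions = [:: set0].
      rewrite /solutions; case E : (below _ _ _ _) => [//|A As].
      have : A \in below (good e) (removed e) n.+1 set0 by rewrite E mem_head.
      rewrite mem_below ?cards0; last by move=> B; apply: good_removed.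
      case/and3P=> /andP[sA _] A0 _.
      have := leq_trans (subset_leq_card sA) (card_RN ees).
      by rewrite m0 leqNgt A0.
    apply: (runs_weaken (k := 1 + 1)); last by lia.
    apply: runs_if => //; first by rewrite /=; lia.
    rewrite /= m0 labels0; apply: (runs_end (@wp_EndSol _ _ _ _ (fun=> True) I)) => //; lia.
  have n0 : 0 < n by have := size_edge_list ees; move: m_gt0; nia.
  have le_T := move_time_le n0; have le_S := sweep_time_bound n0 m_gt0.
  have le_T' : move_time n <= 2700 * (n ^ 2 * m).
    by apply: leq_trans le_T _; rewrite leq_mul2l /= leq_pmulr.
  have nm0 : 0 < n ^ 2 * m by rewrite muln_gt0 expn_gt0 n0.
  have D_large : sweep_time e 0 + move_time n + (sweep_time e 0 + move_time n)
      + move_time n + 20 <= delay_bound by rewrite /delay_bound; lia.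
  have le_prep : prep_time + 4 <= delay_bound.
    by rewrite /prep_time /delay_bound expnS expn1; nia.
  apply: (runs_weaken (k := 1 + (prep_time + 1))); last by lia.
  apply: runs_if => //; first by rewrite /=; lia.
  rewrite /= -lt0n m_gt0; apply: (runs_seq (wp_prep n0)) => [|s1 R1]; first by lia.
  rewrite labels0.
  apply: (runs_seq_end (k := next_output_time e set0 0)
    (@wp_EndSol _ _ _ _ (eq s1) erefl)) => [||s2 <-].
  - by lia.
  - by have := next_output_time_le e set0 0; lia.
  rewrite -[map _ _]cats0.
  have := @traversal n e es delay_bound n0 D_large n set0 good_set0 (leq_addl _ _)
    n 0 [::] (addn0 n) _ s1; rewrite drop0; apply; last by rewrite cards0.
  move=> s R; apply: (runs_weaken (k := 1 + (5 + 1))); last first.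
    by rewrite /next_output_time /move_time /visit_time; lia.
  apply: (loop_silent R (step_stop n0 R)) => [s3 r31|]; last by lia.
  by apply: runs_while_stop => //=; lia.
apply: (runs_weaken (k := 2 + (delay_bound - 2))); last by lia.
apply: runs_seq HQ; last by lia.
apply: wp_assign => //=; rewrite /word_limit /table_base; lia.
Qed.

End Program.

Lemma bigmax_all (T : Type) (F : T -> nat) k s :
  all (fun x => F x <= k) s -> \max_(x <- s) F x <= k.
Proof.
elim: s => [|x s IH] /=; first by rewrite big_nil.
by case/andP=> le_k /IH; rewrite big_cons geq_max le_k.
Qed.

Theorem theorem18 :
  exists (p : com) (C w : nat),
    forall (n : nat) (e : rel 'I_n) (es : seq ('I_n * 'I_n)),
      symmetric e -> irreflexive e ->
      path_free e 8 -> chordal e ->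
      edge_list e es ->
      exists (tr : seq event) (s : state),
        [/\ exec p (init (encode es)) tr s,
            enumerates tr (D_RN e),
            delay tr <= C * (n ^ 2 * num_edges e + 1),
            space tr <= C * (n ^ 2 + 1)
          & max_word tr <= (n + 2) ^ w].
Proof.
exists program, (40 * 1000), 720 => n e es e_sym e_irr pf ch ees.
have le_m := size_edge_list ees.
have b0 : bounded (word_limit n (size es)) (init (encode es)).
  by split=> // a; apply: encode_le.
have [tr [s [ex [ok out le_D _]]]] := runs_program e_sym e_irr ees pf ch b0.
exists tr, s; split=> //.
- exists [seq enum A | A : {set 'I_n} <- solutions e]; split.
  + by rewrite out -map_comp.
  + by apply/allP => _ /mapP[A _ ->]; apply: enum_uniq.
  rewrite -map_comp (eq_map (g := id)) ?map_id; first exact: solutionsP.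
  by move=> A; apply/setP => a; rewrite /= inE mem_enum.
- apply: bigmax_all; apply: sub_all le_D => sg /leq_trans; apply.
  rewrite leq_mul2l /= leq_add2r leq_mul2l (size_num_edges e_sym e_irr ees).
  by rewrite orbT.
- apply: bigmax_all; apply: sub_all ok => ev /andP[/leq_trans le_S _]; apply: le_S.
  by rewrite /space_limit /table_base expnS expn1; lia.
apply: bigmax_all; apply: sub_all ok => ev /andP[_ /leq_trans]; apply.
(* As [m <= n ^ 2], the base is at most [16 * (n + 2) ^ 2], and [16 <= (n + 2) ^ 4]: hence the
   exponent 6, times the 120 of [expr_limit]. *)
rewrite /word_bound /expr_limit (_ : 720 = 6 * 120) // expnM leq_exp2r //.
rewrite /word_limit /table_base; apply: leq_trans (_ : 16 * ((n + 2) * (n + 2)) <= _); first by nia.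
rewrite (_ : 6 = 4 + 2) // expnD -(expnD _ 1 1) leq_mul2r; apply/orP; right.
by rewrite -[16]/(2 ^ 4) leq_exp2r // leq_addl.
Qed.
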